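(* For each integer $\ell\ge 11$, the following assertion is false: ''for all sufficiently large $n$ (as a function of $\ell$), $\mathrm{ex}_{\mathcal{P}}(n,C_{\ell})\le \frac{3(\ell-1)}{\ell}n-\frac{6(\ell+1)}{\ell}$''. In particular, for every positive even integer $k$: (i) if $\ell\ge 11$ and $\ell$ is odd, then $$\mathrm{ex}_{\mathcal{P}}(n,C_{\ell})\ge \frac{9(\ell-5)(\ell-1)}{(3\ell-13)(\ell-1)-4}\left(n-\frac{2(\ell+1)}{\ell-1}\right)$$ for $n=\left((5\ell-5)\frac{k}{2}-\ell+3\right)\left(\frac{3(\ell-1)}{2}-5\right)-(5k-4)$; (ii) if $\ell\ge 11$ and $\ell$ is even, then $$\mathrm{ex}_{\mathcal{P}}(n,C_{\ell})\ge \frac{3(3\ell-16)(\ell-1)}{(3\ell-14)(\ell-1)-4}\left(n-\frac{2(\ell+1)}{\ell-1}\right)$$ for $n=\left((5\ell-5)\frac{k}{2}-\ell+3\right)\left(3\left(\frac{\ell}{2}-1\right)-4\right)-(5k-4)$.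
   Context: All graphs are finite and simple. $C_\ell$ denotes the cycle of length $\ell$. For a graph $H$, the planar Turán number $\mathrm{ex}_{\mathcal{P}}(n,H)$ is the maximum number of edges in an $n$-vertex planar graph with no copy of $H$ as a (not necessarily induced) subgraph. *)

(* Defs.v *)
From HB Require Import structures.
From mathcomp Require Import all_boot all_order all_algebra.
From mathcomp Require Import all_classical all_reals all_analysis.
Import Order.TTheory GRing.Theory Num.Theory.
Import numFieldNormedType.Exports.
Set Implicit Arguments.
Unset Strict Implicit.
Unset Printing Implicit Defensive.
Local Open Scope ring_scope.

Record sgraph (T : finType) := SGraph {
  edges : {set {set T}};
  edgesP : [forall e in edges, #|e| == 2%N] }.

HB.instance Definition _ (T : finType) := [isSub for @edges T].
HB.instance Definition _ (T : finType) := [Finite of sgraph T by <:].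

Lemma cycle_graph_subproof (l : nat) :
  [forall e in [set e in [set [set i; ordS i] | i : 'I_l] | #|e| == 2%N],
    #|e| == 2%N].
Proof. by apply/forall_inP => e; rewrite inE => /andP[]. Qed.

(* This is the cycle C_l only for 3 <= l; the test #|e| == 2 excludes nothing
   once 2 <= l. *)
Definition cycle_graph (l : nat) : sgraph 'I_l := SGraph (cycle_graph_subproof l).

(* Copies are not required to be induced. *)
Definition has_copy (T U : finType) (G : sgraph T) (H : sgraph U) : bool :=
  [exists f : {ffun U -> T},
    injectiveb f && [forall e in edges H, f @: e \in edges G]].

(* Drawings in the plane R x R: [p] places the vertices and the restriction of
   [arc e] to [0, 1] is the simple arc that represents the edge [e]. The values
   of [arc] outside [0, 1], or on sets that are not edges, are irrelevant. *)
Definition plane_drawing (R : realType) (T : finType) (G : sgraph T)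
    (p : T -> R * R) (arc : {set T} -> R -> R * R) : Prop :=
  [/\ injective p,
      forall e, e \in edges G ->
        [/\ {within `[0, 1], continuous (arc e)}%classic,
            {in `[0, 1] &, injective (arc e)} &
            (arc e @` [set 0; 1] = p @` [set` e])%classic],
      forall e t v, e \in edges G -> t \in `]0, 1[ -> arc e t <> p v &
      forall e e' t t', e \in edges G -> e' \in edges G -> e != e' ->
        t \in `]0, 1[ -> t' \in `]0, 1[ -> arc e t <> arc e' t'].

Definition planar (R : realType) (T : finType) (G : sgraph T) : Prop :=
  exists p arc, @plane_drawing R T G p arc.

(* Every n-vertex graph is isomorphic to one on 'I_n. The maximum of an empty
   family is 0. *)
Definition ex_planar (R : realType) (n : nat) (U : finType) (H : sgraph U) : nat :=
  \max_(G : sgraph 'I_n | `[< planar R G >] && ~~ has_copy G H) #|edges G|.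

(* Main.v *)
(* Take a planar multigraph of girth l + 1 with maximum degree 3 all of whose
   faces have length l + 1, draw its vertices as triangles that touch in one
   corner for each edge, and fill every triangle with a planar triangulation
   without cycles of length at least l. A cycle of the resulting graph either
   stays in one triangle, and is shorter than l, or runs along a closed trail
   of the multigraph, and is longer than l.
   The triangulation has t + (l - 1 - 2t) + (2t - 4) vertices with t = (l - 1)/2
   rounded down: a vertex of degree 3 is put into every face of a triangulation
   on t vertices. All edges, except one if l is even, meet the t old vertices,
   so a cycle has at most 2t + (l - 1 - 2t) = l - 1 edges.
   The multigraph consists of two spines joined by two families of nested
   strands. If a set of its edges meets all cuts evenly, it contains each strand
   entirely or not at all, and the edge of a spine behind a given place if and
   only if it contains an odd number of strands attached before that place; two
   strands already give l + 1 edges, and so do any four. *)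
Require Import Defs.
From mathcomp Require Import all_boot all_order all_algebra.
From mathcomp Require Import all_classical all_reals all_analysis.
From mathcomp Require Import fintype finset.
From mathcomp Require Import zify ring lra.
Import Order.TTheory GRing.Theory Num.Theory.
Import numFieldNormedType.Exports.
Set Implicit Arguments.
Unset Strict Implicit.
Unset Printing Implicit Defensive.
Local Open Scope ring_scope.

(** * Straight-line drawings *)

Definition seg (R : realType) (a b : R * R) (t : R) : R * R :=
  ((1 - t) * a.1 + t * b.1, (1 - t) * a.2 + t * b.2).

Lemma segC (R : realType) (a b : R * R) (t : R) : seg b a t = seg a b (1 - t).
Proof. by congr pair; rewrite /=; ring. Qed.

Lemma seg_inj (R : realType) (a b : R * R) : a != b -> injective (seg a b).
Proof.
move=> ab t t' [e1 e2]; apply/eqP/negPn/negP => tt'; case/negP: ab; apply/eqP.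
have tt0 : t' - t != 0 by rewrite subr_eq0 eq_sym.
case: a b e1 e2 => [a1 a2] [b1 b2] /= e1 e2.
by congr pair; apply: (mulfI tt0); lra.
Qed.

Lemma continuous_seg (R : realType) (a b : R * R) : continuous (seg a b).
Proof.
move=> t; have coord_cvg (x y : R) :
    ((1 - t') * x + t' * y @[t' --> t] --> (1 - t) * x + t * y)%classic.
  apply: cvgD; apply: cvgM;
    by [exact: cvg_id|exact: cvg_cst|apply: cvgB; [exact: cvg_cst|exact: cvg_id]].
exact: cvg_pair (coord_cvg a.1 b.1) (coord_cvg a.2 b.2).
Qed.

(** Segments are continuous and injective and have the right end points, so only injectivity of [p]
    and two incidence conditions remain. These are stated for every way to write an edge as a pair,
    since edges are unordered. *)
Lemma planar_straight (R : realType) (T : finType) (G : sgraph T)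
    (p : T -> R * R) :
  injective p ->
  (forall a b v t, [set a; b] \in edges G -> t \in `]0, 1[ ->
     seg (p a) (p b) t <> p v) ->
  (forall a b a' b' t t', [set a; b] \in edges G -> [set a'; b'] \in edges G ->
     t \in `]0, 1[ -> t' \in `]0, 1[ ->
     seg (p a) (p b) t = seg (p a') (p b') t' -> [set a; b] = [set a'; b']) ->
  planar R G.
Proof.
move=> p_inj vtx_free edge_free.
(* An orientation of each edge is picked; the constant arc is a default for sets that are not of the
   form required. *)
pose ends e := [pick ab : T * T | e == [set ab.1; ab.2]].
pose arc e := if ends e is Some ab then seg (p ab.1) (p ab.2) else fun=> 0.
have arcP e : e \in edges G ->
    exists a b, [/\ a != b, e = [set a; b] & arc e = seg (p a) (p b)].
  move=> eG; have /forall_inP/(_ e eG) card_e := edgesP G.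
  have /cards2P[a [b [_ e_ab]]] := card_e.
  rewrite /arc /ends; case: pickP => [[a' b'] /= /eqP e_ab'|/(_ (a, b))].
    by exists a', b'; split=> //; move: card_e; rewrite e_ab' cards2; case: (a' != b').
  by rewrite e_ab eqxx.
exists p, arc; split=> // [e /arcP[a [b [ab -> ->]]]|e t v eG t01|].
- have pab : p a != p b by apply: contra_neq ab => /p_inj.
  split; first by apply: continuous_subspaceT => t; exact: continuous_seg.
    by move=> t t' _ _; exact: seg_inj.
  have seg0 : seg (p a) (p b) 0 = p a.
    by case: (p a) => x y; rewrite /seg /= subr0 !mul1r !mul0r !addr0.
  have seg1 : seg (p a) (p b) 1 = p b.
    by case: (p b) => x y; rewrite /seg /= subrr !mul1r !mul0r !add0r.
  apply/seteqP; split=> [_ [t [->|->] <-]|_ [v /= v_ab <-]] /=.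
  + by exists a; rewrite ?seg0 //= !inE eqxx.
  + by exists b; rewrite ?seg1 //= !inE eqxx orbT.
  + move: v_ab; rewrite !inE => /orP[]/eqP ->; [exists 0|exists 1] => //.
      by left.
    by right.
- have [a [b [_ e_ab ->]]] := arcP _ eG.
  by apply: vtx_free => //; rewrite -e_ab.
- move=> e e' t t' eG e'G /negP ee' t01 t'01 arc_eq; apply: ee'.
  have [a [b [_ e_ab arc_e]]] := arcP _ eG.
  have [a' [b' [_ e_ab' arc_e']]] := arcP _ e'G.
  rewrite e_ab e_ab'; apply/eqP/(edge_free _ _ _ _ t t') => //.
  + by rewrite -e_ab.
  + by rewrite -e_ab'.
  + by rewrite -arc_e -arc_e'.
Qed.

(** * The gadget *)

(* The gadget is a planar triangulation with many vertices and no long cycle.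
   Two poles are joined to each other and to the path q_0, ..., q_(s+e+2);
   inside the face spanned by a pole and q_(e+1+i), q_(e+2+i), for i < s, lies
   a vertex of degree 3. The outer triangle is formed by the poles and the last
   vertex of the path. With t = s + 3 the gadget has 3t - 4 + e vertices. *)
Definition gvert (s : nat) (e : bool) : finType :=
  (bool + 'I_(s + e).+3 + bool * 'I_s)%type.

Definition gpole s (e : bool) (b : bool) : gvert s e := inl (inl b).
Definition gpath s (e : bool) (i : 'I_(s + e).+3) : gvert s e := inl (inr i).
Definition gcentre s (e : bool) (b : bool) (i : 'I_s) : gvert s e := inr (b, i).

Definition gedge (s : nat) (e : bool) : finType :=
  (unit + bool * 'I_(s + e).+3 + 'I_(s + e).+2 + bool * 'I_s * 'I_3)%type.

Definition gsrc s (e : bool) (d : gedge s e) : gvert s e :=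
  match d with
  | inl (inl (inl _)) => gpole _ _ false
  | inl (inl (inr (b, _))) => gpole _ _ b
  | inl (inr i) => gpath (inord i)
  | inr (b, i, _) => gcentre _ b i
  end.

Definition gtgt s (e : bool) (d : gedge s e) : gvert s e :=
  match d with
  | inl (inl (inl _)) => gpole _ _ true
  | inl (inl (inr (_, i))) => gpath i
  | inl (inr i) => gpath (inord i.+1)
  | inr (b, i, k) =>
      if k == 0 :> nat then gpole _ _ b
      else gpath (inord (if k == 1 :> nat then e + i.+1 else e + i.+2)%N)
  end.

Lemma card_gvert s (e : bool) : #|gvert s e| = (3 * s + 5 + e)%N.
Proof. rewrite !card_sum card_prod !card_bool !card_ord; lia. Qed.

Lemma card_gedge s (e : bool) : #|gedge s e| = (9 * s + 9 + 3 * e)%N.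
Proof. by rewrite !card_sum !card_prod card_unit !card_bool !card_ord; lia. Qed.

(* Every edge outside [gextra] meets this set of s + 3 vertices, and a cycle has
   at most two edges at each of them. *)
Definition gcover s (e : bool) : {set gvert s e} :=
  [set v : gvert s e | match v with
           | inl (inl _) => true
           | inl (inr i) => e < i < s + e.+2
           | inr _ => false
           end]%N.

Lemma card_gcover s (e : bool) : #|gcover s e| = (s + 3)%N.
Proof.
pose h (v : bool + 'I_s.+1) : gvert s e :=
  match v with inl b => gpole _ _ b | inr i => gpath (inord (e + i.+1)) end.
have h_inj : injective h.
  move=> [b|i] [b'|i'] //= [] => [->//|/(congr1 val)/=].
  have lt_q (k : 'I_s.+1) : (e + k.+1 < (s + e).+3)%N by have := ltn_ord k; lia.
  by rewrite !inordK // => ii'; congr inr; apply: val_inj => /=; lia.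
suff -> : gcover s e = [set h v | v : bool + 'I_s.+1].
  by rewrite card_imset // card_sum card_bool card_ord; lia.
apply/setP => v; rewrite inE; apply/idP/imsetP => [|[[b|i] _ ->] //=].
  case: v => [[b|i]|//] => [_|/andP[ei i_lt]]; first by exists (inl b).
  have i'_lt : (i - e.+1 < s.+1)%N by lia.
  exists (inr (Ordinal i'_lt)) => //=; congr (inl (inr _)).
  by apply: val_inj; rewrite /= inordK; lia.
by rewrite inordK; have := ltn_ord i; lia.
Qed.

Definition gextra s (e : bool) : {set gvert s e} := [set gpath ord0; gpath (inord 1)].

Lemma gcoverP s (e : bool) (d : gedge s e) :
  [|| gsrc d \in gcover s e, gtgt d \in gcover s e
    | e && ([set gsrc d; gtgt d] == gextra s e)].
Proof.
rewrite !inE; case: d => [[[u|[b i]]|i]|[[b i] k]] //=; last first.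
  by case: k => [[|[|[|//]]]] ? //=; rewrite inordK; have := ltn_ord i; lia.
have := ltn_ord i; case: e i => i lt_i; rewrite !inordK; try lia.
have [i0|i_gt0] := posnP i; last lia.
rewrite i0; apply/orP; right; apply/orP; right; apply/eqP.
by congr [set gpath _; gpath _]; apply: val_inj; rewrite /= inordK.
Qed.

(** * Cycles in the gadget *)

Lemma inj_ordS n (i : 'I_n) : (2 < n)%N -> ordS (ordS i) != i.
Proof.
move=> n_gt2; apply/eqP => /(congr1 val) /=.
have [i_lt|i_ge] := ltnP i.+1 n; first last.
  have -> : i.+1 = n by have := ltn_ord i; lia.
  by rewrite modnn modn_small //; have := ltn_ord i; lia.
rewrite (modn_small i_lt); have [i2_lt|i2_ge] := ltnP i.+2 n.
  by rewrite modn_small //; lia.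
have -> : i.+2 = n by lia.
by rewrite modnn; lia.
Qed.

Lemma big_ordS (n : nat) (F : 'I_n -> nat) :
  (\sum_(i < n) F (ordS i) = \sum_(i < n) F i)%N.
Proof. by rewrite [RHS](reindex_inj (@ordS_inj n)). Qed.

(** If two edges agreed crosswise, shifting twice would fix an index, which [inj_ordS] excludes.
    Hence a cycle uses the edge [gextra] at most once. *)
Lemma cycle_edge_inj (T : finType) l (f : 'I_l -> T) i j : (2 < l)%N ->
  injective f ->
  [set f i; f (ordS i)] = [set f j; f (ordS j)] -> i = j.
Proof.
move=> l_gt2 f_inj eq_ij.
have := set21 (f i) (f (ordS i)); have := set22 (f i) (f (ordS i)).
rewrite eq_ij !inE !(inj_eq f_inj) => Sij /orP[/eqP//|/eqP i_Sj].
move: Sij; rewrite i_Sj (negPf (inj_ordS _ l_gt2)) /=.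
by rewrite (inj_eq (@ordS_inj _)) => /eqP ->.
Qed.

Lemma gadget_cycle_le s (e : bool) l (f : 'I_l -> gvert s e) : (2 < l)%N ->
  injective f ->
  (forall i, exists d, [set f i; f (ordS i)] = [set gsrc d; gtgt d]) ->
  (l <= 2 * s + 6 + e)%N.
Proof.
move=> l_gt2 f_inj f_edge.
pose cov i : nat := f i \in gcover s e.
pose exc i : nat := e && ([set f i; f (ordS i)] == gextra s e).
(* Each edge of the cycle has an end in the cover or is the extra edge. In the sum over the cycle
   every vertex counts twice, which gives l <= 2 (s + 3) + e. *)
have step i : (1 <= cov i + cov (ordS i) + exc i)%N.
  have [d fd] := f_edge i; rewrite /cov /exc fd; move: (gcoverP d).
  have : (f i \in gcover s e) || (f (ordS i) \in gcover s e) =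
         (gsrc d \in gcover s e) || (gtgt d \in gcover s e).
    have meets (A : {set gvert s e}) x y :
        (x \in A) || (y \in A) = ([set x; y] :&: A != set0).
      apply/orP/set0Pn => [[xA|yA]|[z]].
      - by exists x; rewrite !inE eqxx.
      - by exists y; rewrite !inE eqxx orbT.
      - by rewrite !inE => /andP[/orP[]/eqP->]; [left|right].
    by rewrite !meets fd.
  by lia.
have : (\sum_(i < l) 1 <= \sum_(i < l) (cov i + cov (ordS i) + exc i))%N.
  by apply: leq_sum.
rewrite sum1_card card_ord !big_split /= big_ordS => le_l.
have cov_le : (\sum_(i < l) cov i <= s + 3)%N.
  rewrite -(card_gcover s e) -big_mkcond sum1_card.
  rewrite -(card_imset _ f_inj) subset_leq_card //.
  by apply/subsetP => _ /imsetP[i + ->].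
have exc_le1 : (\sum_(i < l) exc i <= 1)%N.
  rewrite -big_mkcond sum1_card; apply/card_le1_eqP => i j.
  rewrite !unfold_in => /andP[_ /eqP fi] /andP[_ /eqP fj].
  by apply: (cycle_edge_inj l_gt2 f_inj); rewrite fi fj.
have exc_e i : (exc i <= e)%N by rewrite /exc; case: (e : bool) (_ == _) => -[].
have : (\sum_(i < l) exc i <= l * e)%N.
  by rewrite -[X in (X * e)%N]card_ord -sum_nat_const leq_sum.
move: exc_le1 le_l cov_le; move: (\sum_(i < l) exc i)%N (\sum_(i < l) cov i)%N.
by move=> {step exc_e}; case: (e : bool) => n c; lia.
Qed.

(** * Drawing of the gadget *)

Definition gpos (R : realType) s (e : bool) (v : gvert s e) : R * R :=
  match v with
  | inl (inl b) => (if b then 2 else 0, 0)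
  | inl (inr i) => (1, i.+1%:R)
  | inr (b, i) => (if b then 3 / 2 else 1 / 2, (e + i.+2)%:R / 2 + 1 / 4)
  end.

(* Each point of the drawing lies on one vertex or in the interior of one edge,
   which is read off the point: the slope seen from the nearer pole tells apart
   everything that is off the bottom line and off the path. *)
Definition side_cell (R : realType) s (e b : bool) (x y : R) :
    gvert s e + gedge s e :=
  let j := Num.trunc (y / x) in
  let f := y / x - j%:R in
  if f == 0 then inr (inl (inl (inr (b, inord j.-1)))) else
  if insub (j - e.+2)%N is Some i then
    if f == 1 / 2 then
      if x == 1 / 2 then inl (gcentre e b i) else inr (inr (b, i, inord 0))
    else inr (inr (b, i, inord (if f < 1 / 2 then 1 else 2)))
  else inr (inl (inl (inl tt))).

Definition gcell (R : realType) s (e : bool) (P : R * R) :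
    gvert s e + gedge s e :=
  let: (x, y) := P in
  if y == 0 then
    if x == 0 then inl (gpole s e false) else
    if x == 2 then inl (gpole s e true) else inr (inl (inl (inl tt)))
  else if x == 1 then
    let j := Num.trunc y in
    if y == j%:R then inl (gpath (inord j.-1)) else inr (inl (inr (inord j.-1)))
  else if x < 1 then side_cell s e false x y else side_cell s e true (2 - x) y.

(** For [b = true] this is the reflection in the line x = 1 that carries the path; it exchanges the
    poles, so one computation serves both sides. *)
Definition mirror (R : realType) (b : bool) (x : R) := if b then 2 - x else x.

Lemma gcell_mirror (R : realType) s (e b : bool) (x y : R) : 0 < y -> x < 1 ->
  gcell s e (mirror b x, y) = side_cell s e b x y.
Proof.
move=> y_gt0 x_lt1; rewrite /gcell gt_eqF // /mirror; case: b => /=.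
  have x'_gt1 : 1 < 2 - x by lra.
  by rewrite gt_eqF // ltNge ltW //= subKr.
by rewrite lt_eqF // x_lt1.
Qed.

Lemma truncnD_lt1 (R : realType) (j : nat) (f : R) : 0 <= f < 1 ->
  Num.trunc (j%:R + f) = j.
Proof. by move=> f01; apply: truncn_def; rewrite -natr1; lra. Qed.

Lemma side_cell_ray (R : realType) s (e b : bool) (j : nat) (x : R) : 0 < x ->
  side_cell s e b x (j%:R * x) = inr (inl (inl (inr (b, inord j.-1)))).
Proof.
move=> x_gt0; rewrite /side_cell (mulfK (lt0r_neq0 x_gt0)).
by rewrite natrK subrr eqxx.
Qed.

(** Seen from the pole, path vertices have integer slopes. Between the slopes e + i + 2 and e + i +
    3 lies only centre i, at fraction 1/2, and the fraction f of the slope separates its three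
    edges. *)
Lemma side_cell_wedge (R : realType) s (e b : bool) (i : 'I_s) (x f : R) :
  0 < x -> 0 < f < 1 ->
  side_cell s e b x (((e + i.+2)%:R + f) * x) =
    if f == 1 / 2 then
      if x == 1 / 2 then inl (gcentre e b i) else inr (inr (b, i, inord 0))
    else inr (inr (b, i, inord (if f < 1 / 2 then 1 else 2))).
Proof.
move=> x_gt0 f01; rewrite /side_cell (mulfK (lt0r_neq0 x_gt0)) truncnD_lt1; last by lra.
rewrite [_ + f]addrC addrK gt_eqF; last by lra.
have -> : (e + i.+2 - e.+2)%N = i by lia.
by rewrite valK.
Qed.

Lemma gcell_vertex (R : realType) s (e : bool) (v : gvert s e) :
  gcell s e (gpos R v) = inl v.
Proof.
case: v => [[b|i]|[b i]].
- by rewrite /gpos /gcell eqxx; case: b; rewrite ?pnatr_eq0 ?eqxx.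
- rewrite /gpos /gcell pnatr_eq0 /= eqxx natrK eqxx /=.
  by rewrite inord_val.
- have -> : gpos R (inr (b, i) : gvert s e) =
      (mirror b (1 / 2), ((e + i.+2)%:R + 1 / 2) * (1 / 2)).
    by rewrite /gpos /mirror; congr pair; [case: (b); lra|lra].
  rewrite gcell_mirror ?side_cell_wedge ?eqxx //; [lra..|].
  by have := ler0n R (e + i.+2)%N; lra.
Qed.

(** A label computed from the point alone shows, together with [gcell_vertex], that open edges are
    pairwise disjoint and avoid all vertices, without a comparison of pairs of segments. *)
Lemma gcell_edge (R : realType) s (e : bool) (d : gedge s e) (t : R) :
  0 < t < 1 -> gcell s e (seg (gpos R (gsrc d)) (gpos R (gtgt d)) t) = inr d.
Proof.
move=> t01; case: d => [[[[]|[b i]]|i]|[[b i] k]].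
- rewrite /gcell /seg /= !mulr0 !add0r eqxx gt_eqF ?lt_eqF //; lra.
- have -> : seg (gpos R (gpole s e b)) (gpos R (gpath i)) t =
      (mirror b t, i.+1%:R * t).
    by rewrite /seg /mirror /=; congr pair; [case: (b); lra|lra].
  have i_gt0 : 0 < i.+1%:R :> R by rewrite ltr0n.
  rewrite gcell_mirror ?side_cell_ray /= ?inord_val //; [lra| |lra].
  by apply: mulr_gt0; lra.
- rewrite /gcell /seg /= !inordK; [|have := ltn_ord i; lia..].
  have -> : (1 - t) * 1 + t * 1 = 1 :> R by lra.
  have -> : (1 - t) * i.+1%:R + t * i.+2%:R = i.+1%:R + t :> R.
    by rewrite -[i.+2%:R]natr1; lra.
  have i_gt0 : 0 < i.+1%:R :> R by rewrite ltr0n.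
  have -> : (i.+1%:R + t == 0) = false by rewrite gt_eqF //; lra.
  rewrite eqxx truncnD_lt1; last by lra.
  have -> : (i.+1%:R + t == i.+1%:R) = false by rewrite gt_eqF //; lra.
  by rewrite /= inord_val.
- have k_lt := ltn_ord k; have i_lt := ltn_ord i.
  have j_ge0 := ler0n R (e + i.+2)%N.
  have kE (m : nat) : k = m :> nat -> k = inord m.
    by move=> <-; rewrite inord_val.
  have wedge x f : 0 < x -> x < 1 -> 0 < f < 1 ->
      seg (gpos R (gsrc (inr (b, i, k) : gedge s e)))
          (gpos R (gtgt (inr (b, i, k) : gedge s e))) t
        = (mirror b x, ((e + i.+2)%:R + f) * x) ->
      gcell s e (seg (gpos R (gsrc (inr (b, i, k) : gedge s e)))
          (gpos R (gtgt (inr (b, i, k) : gedge s e))) t) =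
      if f == 1 / 2 then
        if x == 1 / 2 then inl (gcentre e b i) else inr (inr (b, i, inord 0))
      else inr (inr (b, i, inord (if f < 1 / 2 then 1 else 2))).
    move=> x_gt0 x_lt1 f01 ->; rewrite gcell_mirror ?side_cell_wedge //.
    by apply: mulr_gt0; lra.
  have [k0|[k1|k2]] : k = 0 :> nat \/ k = 1 :> nat \/ k = 2 :> nat by lia.
  + rewrite (wedge ((1 - t) / 2) (1 / 2)); [|lra..|].
      by rewrite eqxx lt_eqF -?(kE _ k0) //; lra.
    by rewrite /seg /mirror /= k0 /=; congr pair; [case: (b); lra|lra].
  (* Up to reflection, x = (1 + t) / 2 on the edge from a centre to its lower path vertex, and the
     fraction of the slope y / x falls from 1/2 to 0. On the upper edge, treated next, it rises from
     1/2 to 1. *)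
  + have t1 : 1 + t != 0 by rewrite gt_eqF //; lra.
    have ft : (1 - t) / (2 * (1 + t)) * (1 + t) = (1 - t) / 2 by field.
    have f_gt0 : 0 < (1 - t) / (2 * (1 + t)) by apply: divr_gt0; lra.
    have f_lt : (1 - t) / (2 * (1 + t)) < 1 / 2.
      by rewrite ltr_pdivrMr; lra.
    rewrite (wedge ((1 + t) / 2) ((1 - t) / (2 * (1 + t)))); [|lra|lra| |].
    * by rewrite f_lt lt_eqF -?(kE _ k1).
    * by rewrite f_gt0 (lt_trans f_lt) //; lra.
    * rewrite /seg /mirror /= k1 /= inordK; last by lia.
      congr pair; first by case: (b); lra.
      by rewrite -addnS; nra.
  + have t1 : 1 + t != 0 by rewrite gt_eqF //; lra.
    have ft : (1 + 3 * t) / (2 * (1 + t)) * (1 + t) = (1 + 3 * t) / 2 by field.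
    have f_lt1 : (1 + 3 * t) / (2 * (1 + t)) < 1 by rewrite ltr_pdivrMr; lra.
    have f_gt : 1 / 2 < (1 + 3 * t) / (2 * (1 + t)).
      by rewrite ltr_pdivlMr; lra.
    rewrite (wedge ((1 + t) / 2) ((1 + 3 * t) / (2 * (1 + t)))); [|lra|lra| |].
    * by rewrite ltNge (ltW f_gt) gt_eqF -?(kE _ k2).
    * by rewrite f_lt1 andbT (lt_trans _ f_gt) //; lra.
    * rewrite /seg /mirror /= k2 /= inordK; last by lia.
      congr pair; first by case: (b); lra.
      by rewrite -[(e + i.+2).+1%:R]natr1; nra.
Qed.

(** * Contact systems of triangles *)

Definition bary (R : realType) (c : option bool -> R * R) (u v : R) : R * R :=
  let a := c (Some false) in let b := c (Some true) in let z := c None in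
  (a.1 + u * (b.1 - a.1) + v * (z.1 - a.1),
   a.2 + u * (b.2 - a.2) + v * (z.2 - a.2)).

(* Triangles [corner g], for g : I, that meet only in common corners; a member
   of K is such a meeting point, given by the two corners that coincide there.
   In the multigraph with vertex set I and edge set K, every nonempty member of
   the cycle space has more than l edges; the cycle space is described as the
   sets that have an even number of edges in every cut. *)
Record contact_system (R : realType) (l : nat) (I K : finType) := ContactSystem {
  corner : I -> option bool -> R * R;
  fst_end : K -> I * option bool;
  snd_end : K -> I * option bool;
  corner_free : forall g, let: a := corner g (Some false) in
    let: b := corner g (Some true) in let: z := corner g None in
    (b.1 - a.1) * (z.2 - a.2) - (b.2 - a.2) * (z.1 - a.1) != 0;
  corner_meet : forall c,
    corner (fst_end c).1 (fst_end c).2 = corner (snd_end c).1 (snd_end c).2;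
  snd_end_inj : injective snd_end;
  fst_end_neq : forall c c', fst_end c != snd_end c';
  triangles_meet : forall g g' (u v u' v' : R), g != g' ->
    0 <= u -> 0 <= v -> u + v <= 1 -> 0 <= u' -> 0 <= v' -> u' + v' <= 1 ->
    bary (corner g) u v = bary (corner g') u' v' ->
    exists c, [set g; g'] = [set (fst_end c).1; (snd_end c).1] /\
      bary (corner g) u v = corner (fst_end c).1 (fst_end c).2;
  girth_gt : forall D : {set K}, D != set0 ->
    (forall phi : I -> bool,
       ~~ odd #|[set c in D | phi (fst_end c).1 != phi (snd_end c).1]|) ->
    (l < #|D|)%N }.

Definition gcorner s (e : bool) (k : option bool) : gvert s e :=
  if k is Some b then gpole s e b else gpath ord_max.

Lemma gcorner_inj s (e : bool) : injective (@gcorner s e).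
Proof. by move=> [[]|] [[]|]. Qed.

Definition gheight (R : realType) s (e : bool) : R := (s + e).+3%:R.

(** The affine map from the triangle with corners (0, 0), (2, 0), (1, [gheight]), which bounds the
    gadget, to the triangle [c]. *)
Definition place (R : realType) s (e : bool) (c : option bool -> R * R)
    (P : R * R) : R * R :=
  bary c (P.1 / 2 - P.2 / gheight R s e / 2) (P.2 / gheight R s e).

Definition in_gadget (R : realType) s (e : bool) (P : R * R) : Prop :=
  [/\ 0 <= P.2, P.2 / gheight R s e <= P.1 & P.1 + P.2 / gheight R s e <= 2].

Lemma gheight_gt0 (R : realType) s (e : bool) : 0 < gheight R s e.
Proof. by rewrite ltr0n. Qed.

Lemma place_corner (R : realType) s (e : bool) (c : option bool -> R * R) k :
  place s e c (gpos R (gcorner s e k)) = c k.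
Proof.
have h_div : (s + e).+3%:R / gheight R s e = 1 :> R by rewrite divff ?pnatr_eq0.
rewrite /place /bary; case: k => [[]|] /=; rewrite ?h_div ?mul0r.
- by case: (c (Some true)) => x y /=; congr pair; lra.
- by case: (c (Some false)) => x y /=; congr pair; lra.
- by case: (c None) => x y /=; congr pair; lra.
Qed.

Lemma place_seg (R : realType) s (e : bool) (c : option bool -> R * R) P Q t :
  seg (place s e c P) (place s e c Q) t = place s e c (seg P Q t).
Proof.
rewrite /seg /place /bary /=; move: (gheight R s e)^-1 => h.
by congr pair; ring.
Qed.

Lemma in_gadget_seg (R : realType) s (e : bool) (P Q : R * R) t : 0 <= t <= 1 ->
  in_gadget s e P -> in_gadget s e Q -> in_gadget s e (seg P Q t).
Proof.
rewrite /in_gadget /seg /=; move: (gheight R s e)^-1 => h t01.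
by case=> P1 P2 P3 [Q1 Q2 Q3]; split; nra.
Qed.

Lemma in_gadget_gpos (R : realType) s (e : bool) (v : gvert s e) :
  in_gadget s e (gpos R v).
Proof.
have h_gt0 := gheight_gt0 R s e; have h_neq0 := lt0r_neq0 h_gt0.
case: v => [[b|i]|[b i]] /=.
- by split=> /=; rewrite ?mul0r; case: b; lra.
- have i_le : i.+1%:R <= gheight R s e by rewrite ler_nat.
  have : i.+1%:R / gheight R s e <= 1 by rewrite ler_pdivrMr ?mul1r.
  move=> y_le; split=> /=; [exact: ler0n|exact: y_le|].
  by rewrite -lerBrDl (le_trans y_le) //; lra.
- have i_le : (e + i.+2)%:R + 1 / 2 <= gheight R s e.
    have i_le : (e + i.+2).+1%:R <= gheight R s e.
      by rewrite ler_nat; have := ltn_ord i; lia.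
    by move: i_le; rewrite -natr1; lra.
  have j_ge0 := ler0n R (e + i.+2)%N.
  have : ((e + i.+2)%:R / 2 + 1 / 4) / gheight R s e <= 1 / 2.
    by rewrite ler_pdivrMr //; lra.
  rewrite /in_gadget /=; move: (_ / gheight R s e) => q q_le.
  by split; [|case: (b)..]; lra.
Qed.

Lemma place_inj (R : realType) s (e : bool) l (I K : finType)
    (S : contact_system R l I K) g :
  injective (place s e (corner S g)).
Proof.
have h_gt0 := gheight_gt0 R s e; have h_neq0 := lt0r_neq0 h_gt0.
move=> [x y] [x' y'] [/=]; have /= := corner_free S g; rewrite /place /bary /=.
move: (corner S g (Some false)) (corner S g (Some true)) (corner S g None).
move=> [a1 a2] [b1 b2] [z1 z2] /= det e1 e2.
set v := y / _ in e1 e2; set v' := y' / _ in e1 e2.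
set u := x / 2 - _ in e1 e2; set u' := x' / 2 - _ in e1 e2.
have d1 : (u - u') * (b1 - a1) + (v - v') * (z1 - a1) = 0 by lra.
have d2 : (u - u') * (b2 - a2) + (v - v') * (z2 - a2) = 0 by lra.
(* Cramer's rule, with the determinant that [corner_free] keeps away from 0. *)
have eu : u = u'.
  apply/eqP; rewrite -subr_eq0 -(mulIr_eq0 _ (mulIf det)); apply/eqP.
  transitivity ((z2 - a2) * ((u - u') * (b1 - a1) + (v - v') * (z1 - a1)) -
    (z1 - a1) * ((u - u') * (b2 - a2) + (v - v') * (z2 - a2))); first by ring.
  by rewrite d1 d2 !mulr0 subrr.
have ev : v = v'.
  apply/eqP; rewrite -subr_eq0 -(mulIr_eq0 _ (mulIf det)); apply/eqP.
  transitivity ((b1 - a1) * ((u - u') * (b2 - a2) + (v - v') * (z2 - a2)) -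
    (b2 - a2) * ((u - u') * (b1 - a1) + (v - v') * (z1 - a1))); first by ring.
  by rewrite d1 d2 !mulr0 subrr.
congr pair; last by move: ev; rewrite /v /v' => /(mulIf (invr_neq0 h_neq0)).
by move: eu ev; rewrite /u /u' -/v -/v'; lra.
Qed.

Lemma places_meet (R : realType) s (e : bool) l (I K : finType)
    (S : contact_system R l I K) g g' P P' : g != g' ->
  in_gadget s e P -> in_gadget s e P' ->
  place s e (corner S g) P = place s e (corner S g') P' ->
  exists c, [set g; g'] = [set (fst_end S c).1; (snd_end S c).1] /\
    place s e (corner S g) P = corner S (fst_end S c).1 (fst_end S c).2.
Proof.
move=> gg' [P0 P1 P2] [P'0 P'1 P'2]; have h_gt0 := gheight_gt0 R s e.
have := divr_ge0 P'0 (ltW h_gt0); have := divr_ge0 P0 (ltW h_gt0).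
move: P1 P2 P'1 P'2; rewrite /place.
move: (P.2 / gheight R s e) (P'.2 / gheight R s e) => q q' ? ? ? ? ? ? meet.
by apply: triangles_meet gg' _ _ _ _ _ _ meet; lra.
Qed.

(** Distinct triangles share only corners, and [gcell] labels corners as vertices; so a point
    labelled as an edge lies in one triangle only. This carries disjointness from one gadget to the
    whole drawing. *)
Lemma place_cell (R : realType) s (e : bool) l (I K : finType)
    (S : contact_system R l I K) g g' P P' d :
  in_gadget s e P -> in_gadget s e P' -> gcell s e P = inr d ->
  place s e (corner S g) P = place s e (corner S g') P' -> g = g' /\ P = P'.
Proof.
move=> Pin P'in Pd PP'; have [gg'|/eqP gg'] := eqVneq g g'; last first.
  have [c [/setP gc Pc]] := places_meet (introN eqP gg') Pin P'in PP'.
  have [k Pk] : exists k, place s e (corner S g) P = corner S g k.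
    move: (gc g); rewrite !inE eqxx => /esym/orP[]/eqP g_c.
      by exists (fst_end S c).2; rewrite Pc -g_c.
    by exists (snd_end S c).2; rewrite Pc corner_meet -g_c.
  move: Pk; rewrite -(place_corner s e) => /place_inj P_k.
  by move: Pd; rewrite P_k gcell_vertex.
by split=> //; apply: (@place_inj R s e l I K S g); rewrite PP' gg'.
Qed.

(** * Parity along a cycle and counting of vertices *)

Lemma even_changes l (b : 'I_l -> bool) :
  ~~ odd #|[set i | b i != b (ordS i)]|.
Proof.
(* Modulo 2 a change at i is b i + b (i + 1), and every value occurs twice in the sum over the
   cycle. *)
pose both := (\sum_(i < l) (b i && b (ordS i)))%N.
have count_b :
    (#|[set i | b i != b (ordS i)]| + (both + both) = (\sum_(i < l) b i).*2)%N.
  rewrite -addnn -[X in (_ = X + _)%N]big_ordS -sum1dep_card big_mkcond.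
  rewrite -!big_split /=; apply: eq_bigr => i _.
  by case: (b i); case: (b (ordS i)).
have := congr1 odd count_b.
by rewrite oddD addnn !odd_double addbF => ->.
Qed.

Lemma ordS_const (T : eqType) l (f : 'I_l -> T) i j :
  (forall k, f (ordS k) = f k) -> f i = f j.
Proof.
move=> f_const; suff f0 k (k_lt : (k < l)%N) (l_gt0 : (0 < l)%N) :
    f (Ordinal k_lt) = f (Ordinal l_gt0).
  have l_gt0 : (0 < l)%N by have := ltn_ord i; lia.
  case: i j => [i i_lt] [j j_lt].
  by rewrite (f0 i i_lt l_gt0) (f0 j j_lt l_gt0).
elim: k k_lt => [|k IH] k_lt; first by congr f; apply: val_inj.
rewrite -(IH (ltnW k_lt)) -[in RHS]f_const; congr f; apply: val_inj => /=.
by rewrite modn_small.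
Qed.

(** Labels in [Z] share their point with a label outside [Z]: each joint saves one vertex when the
    corners that coincide are merged. *)
Lemma size_points (R : realType) (T : finType) (pos : T -> R * R) (Z : {set T}) :
  (forall z, z \in Z -> exists2 w, w \notin Z & pos w = pos z) ->
  (size (undup [seq pos w | w <- enum T]) + #|Z| <= #|T|)%N.
Proof.
move=> redundant; rewrite -(cardsC Z) addnC leq_add2l.
rewrite cardE -(size_map pos); apply: uniq_leq_size; first exact: undup_uniq.
move=> x; rewrite mem_undup => /mapP[w _ ->].
have [/redundant[w' w'Z <-]|wZ] := boolP (w \in Z).
  by apply: map_f; rewrite mem_enum inE.
by apply: map_f; rewrite mem_enum inE.
Qed.

(** The graph must have exactly n vertices. Isolated ones are added at heights above [B], where no
    segment between old points can reach them. *)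
Lemma padded_points (R : realType) (T : finType) (pos : T -> R * R) n :
  (size (undup [seq pos w | w <- enum T]) <= n)%N ->
  exists (p : 'I_n -> R * R) (rank : T -> 'I_n) (B : R),
    [/\ injective p, forall w, p (rank w) = pos w, forall w, (pos w).2 <= B &
        forall i, (exists w, p i = pos w) \/ B < (p i).2].
Proof.
set pts := undup _ => pts_le.
pose B : R := \sum_(w : T) `|(pos w).2|.
have B_ge w : (pos w).2 <= B.
  by rewrite (le_trans (ler_norm _)) // /B (bigD1 w) //= lerDl sumr_ge0.
pose far := [seq (0, B + j.+1%:R) : R * R | j <- iota 0 n].
have far_gt x : x \in far -> B < x.2.
  by case/mapP => j _ ->; rewrite /= ltrDl ltr0n.
have mem_pts w : pos w \in pts by rewrite mem_undup map_f // mem_enum.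
have ptsP x : x \in pts -> exists w, x = pos w.
  by rewrite mem_undup => /mapP[w _ ->]; exists w.
have all_uniq : uniq (pts ++ far).
  rewrite cat_uniq undup_uniq map_inj_uniq ?iota_uniq ?andbT /=.
    apply/hasPn => x /far_gt B_lt; apply/negP => /ptsP[w x_w].
    by move: B_lt; rewrite x_w ltNge B_ge.
  by move=> j j' [] /addrI /eqP; rewrite eqr_nat => /eqP [].
have n_le : (n <= size (pts ++ far))%N.
  by rewrite size_cat size_map size_iota leq_addl.
have rank_lt w : (index (pos w) pts < n)%N.
  by rewrite (leq_trans _ pts_le) // index_mem.
exists (fun i => nth 0 (pts ++ far) i), (fun w => Ordinal (rank_lt w)), B.
split=> // [i j /eqP|w|i].
- rewrite nth_uniq // ?(leq_trans _ n_le) // => /eqP; exact: val_inj.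
- by rewrite nth_cat index_mem mem_pts nth_index.
- have : nth 0 (pts ++ far) i \in pts ++ far.
    by rewrite mem_nth // (leq_trans _ n_le).
  by rewrite mem_cat => /orP[/ptsP|/far_gt]; [left|right].
Qed.

Lemma cycle_edge l i : (1 < l)%N ->
  [set i; ordS i] \in edges (cycle_graph l).
Proof.
move=> l_gt1; rewrite inE; apply/andP; split; first by apply/imsetP; exists i.
rewrite cards2; suff : i != ordS i by move=> ->.
apply/eqP => /(congr1 val) /=; have [i_lt|i_ge] := ltnP i.+1 l.
  by rewrite modn_small //; lia.
have -> : i.+1 = l by have := ltn_ord i; lia.
by rewrite modnn; have := ltn_ord i; lia.
Qed.

(* A gadget is drawn in each triangle. A cycle that leaves its gadget does so at
   contacts, which are distinct and meet every cut evenly. *)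
Lemma contact_bound (R : realType) s (e : bool) l (I K : finType)
    (S : contact_system R l I K) n :
  l = (2 * s + 7 + e)%N -> (#|I| * (3 * s + 5 + e) <= n + #|K|)%N ->
  (#|I| * (9 * s + 9 + 3 * e) <= ex_planar R n (cycle_graph l))%N.
Proof.
move=> l_eq n_ge; have l_gt2 : (2 < l)%N by rewrite l_eq; lia.
pose pos (w : I * gvert s e) := place s e (corner S w.1) (gpos R w.2).
pose at_corner (c : I * option bool) := (c.1, gcorner s e c.2).
have pos_corner c : pos (at_corner c) = corner S c.1 c.2 by exact: place_corner.
have at_corner_inj : injective at_corner.
  by move=> [g k] [g' k'] [-> /gcorner_inj ->].
have pts_le : (size (undup [seq pos w | w <- enum {: I * gvert s e}]) <= n)%N.
  (* The second label of each joint is redundant: [snd_end_inj] counts these labels, and by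
     [fst_end_neq] the first label is never one of them. *)
  pose Z := [set at_corner (snd_end S c) | c : K].
  have := @size_points _ _ pos Z; rewrite card_imset; last first.
    exact: (inj_comp at_corner_inj (@snd_end_inj _ _ _ _ S)).
  rewrite card_prod card_gvert => size_le; rewrite -(leq_add2r #|K|).
  apply: leq_trans n_ge; apply: size_le => _ /imsetP[c _ ->].
  exists (at_corner (fst_end S c)); last by rewrite !pos_corner corner_meet.
  apply/imsetP => -[c' _ /at_corner_inj /eqP].
  by rewrite (negPf (fst_end_neq S c c')).
have [p [rank [B [p_inj p_rank B_ge p_far]]]] := padded_points pts_le.
pose ends (x : I * gedge s e) :=
  [set rank (x.1, gsrc x.2); rank (x.1, gtgt x.2)].
pose line (x : I * gedge s e) := seg (gpos R (gsrc x.2)) (gpos R (gtgt x.2)).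
have line_in x (t : R) : 0 <= t <= 1 -> in_gadget s e (line x t).
  by move=> t01; apply: in_gadget_seg => //; exact: in_gadget_gpos.
have p_line x t : seg (p (rank (x.1, gsrc x.2))) (p (rank (x.1, gtgt x.2))) t =
    place s e (corner S x.1) (line x t) by rewrite !p_rank place_seg.
have seg_line x a b (t : R) : [set a; b] = ends x -> 0 < t < 1 ->
    exists2 t', 0 < t' < 1 &
      seg (p a) (p b) t = place s e (corner S x.1) (line x t').
  move=> ab_x t01; have := set21 a b; have := set22 a b; rewrite ab_x !inE.
  have [/eqP a_b|ab] := boolP (a == b).
    have : rank (x.1, gsrc x.2) \in [set a; b] by rewrite ab_x set21.
    have : rank (x.1, gtgt x.2) \in [set a; b] by rewrite ab_x set22.
    rewrite !inE a_b !orbb => /eqP gtgt_b /eqP gsrc_b _ _.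
    by exists t => //; rewrite -p_line gtgt_b gsrc_b.
  move=> /orP[]/eqP b_x /orP[]/eqP a_x.
  - by move: ab; rewrite b_x a_x eqxx.
  - exists (1 - t); first by lra.
    by rewrite segC -p_line a_x b_x; congr seg; lra.
  - by exists t => //; rewrite -p_line a_x b_x.
  - by move: ab; rewrite b_x a_x eqxx.
have line_inj x x' (t t' : R) : 0 < t < 1 -> 0 < t' < 1 ->
    place s e (corner S x.1) (line x t) =
    place s e (corner S x'.1) (line x' t') -> x = x'.
  move=> t01 t'01 /place_cell; case: x x' => [g d] [g' d'] /=.
  case/(_ d); [by apply: line_in; lra..| |move=> -> ll'].
    exact: gcell_edge.
  have := @gcell_edge R s e d t t01; rewrite -[seg _ _ t]/(line (g', d) t) ll'.
  by rewrite gcell_edge // => -[->].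
(* Any interior point identifies its edge; the midpoint is used. *)
pose half : R := 1 / 2; have half01 : 0 < half < 1 by rewrite /half; lra.
have ends_inj : injective ends.
  move=> x x' xx'.
  have [t t01] := @seg_line x' _ _ half xx' half01.
  by rewrite p_line => /(line_inj _ _ _ _ half01 t01).
have ends_card x : #|ends x| == 2%N.
  rewrite cards2; suff : rank (x.1, gsrc x.2) != rank (x.1, gtgt x.2) by move=> ->.
  apply/eqP => /(congr1 p); rewrite !p_rank => /place_inj.
  move=> gpos_eq; have := gcell_vertex R (gsrc x.2).
  have := gcell_edge x.2 half01; rewrite gpos_eq.
  have -> : seg (gpos R (gtgt x.2)) (gpos R (gtgt x.2)) half = gpos R (gtgt x.2).
    by rewrite /seg; case: (gpos _ _) => y z /=; congr pair; lra.
  by move=> ->.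
have edges_subproof :
    [forall d in [set ends x | x : I * gedge s e], #|d| == 2%N].
  by apply/forall_inP => _ /imsetP[x _ ->].
pose G := SGraph edges_subproof.
have card_G : #|edges G| = (#|I| * (9 * s + 9 + 3 * e))%N.
  by rewrite card_imset // card_prod card_gedge.
have planar_G : planar R G.
  apply: (planar_straight p_inj).
    move=> a b v t /imsetP[x _ ab_x]; rewrite in_itv /= => t01.
    have [t' t'01 ->] := seg_line _ _ _ _ ab_x t01.
    case: (p_far v) => [[w ->]|B_lt pv].
      move=> /place_cell; case/(_ x.2).
      - by apply: line_in; lra.
      - exact: in_gadget_gpos.
      - exact: gcell_edge.
      - move=> _ line_w; have := gcell_edge x.2 t'01.
        by rewrite -[seg _ _ t']/(line x t') line_w gcell_vertex.
    (* A padding vertex lies above both ends of the segment, hence above the segment. *)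
    move: B_lt; rewrite -pv -p_line !p_rank.
    have := B_ge (x.1, gsrc x.2); have := B_ge (x.1, gtgt x.2).
    move: (pos (x.1, gsrc x.2)) (pos (x.1, gtgt x.2)) => [y1 y] [y1' y'] /=.
    by move=> y'B yB; rewrite ltNge => /negP; apply; nra.
  move=> a b a' b' t t' /imsetP[x _ ab_x] /imsetP[x' _ ab_x'].
  rewrite !in_itv /= => t01 t'01.
  have [r r01 ->] := seg_line _ _ _ _ ab_x t01.
  have [r' r'01 ->] := seg_line _ _ _ _ ab_x' t'01.
  by move/(line_inj _ _ _ _ r01 r'01) => xx'; rewrite ab_x ab_x' xx'.
suff no_cycle : ~~ has_copy G (cycle_graph l).
  rewrite -card_G /ex_planar.
  apply: (@leq_bigmax_cond _ _ (fun G : sgraph 'I_n => #|edges G|)).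
  by rewrite no_cycle andbT; exact/asboolP.
apply/existsP => -[f /andP[/injectiveP f_inj /forall_inP f_edge]].
have /fin_all_exists[x fx] : forall i, exists x, [set f i; f (ordS i)] = ends x.
  move=> i; have /f_edge := cycle_edge i (ltnW l_gt2).
  by rewrite imsetU1 imset_set1 => /imsetP[y _ ->]; exists y.
pose g i := (x i).1.
have f_src i : exists v, f i = rank (g i, v).
  by have := set21 (f i) (f (ordS i)); rewrite fx !inE => /orP[]/eqP ->;
    eexists.
have f_tgt i : exists v, f (ordS i) = rank (g i, v).
  by have := set22 (f i) (f (ordS i)); rewrite fx !inE => /orP[]/eqP ->;
    eexists.
pose turns := [set i | g i != g (ordS i)].
(* Without turns the cycle stays in one gadget, where [gadget_cycle_le] bounds its length by l -
   1. *)
have [turns0|turns_n0] := eqVneq turns set0.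
  have l_gt0 : (0 < l)%N by lia.
  pose g0 := g (Ordinal l_gt0).
  have g_const i : g i = g0.
    apply: ordS_const => k; apply/eqP; rewrite eq_sym.
    by move/setP/(_ k): turns0; rewrite !inE => /negbFE.
  have rank_inj : injective (fun v => rank (g0, v)).
    move=> v v' /(congr1 p); rewrite !p_rank => /place_inj vv'.
    by have := gcell_vertex R v; rewrite vv' gcell_vertex => -[].
  have /fin_all_exists[v fv] : forall i, exists v, f i = rank (g0, v).
    by move=> i; rewrite -(g_const i).
  suff : (l <= 2 * s + 6 + e)%N by rewrite l_eq; lia.
  apply: (gadget_cycle_le (f := v) l_gt2) => [i j vij|i].
    by apply: f_inj; rewrite !fv vij.
  exists (x i).2; apply: (imset_inj rank_inj).
  rewrite !imsetU1 !imset_set1 -!fv fx /ends.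
  by rewrite -[(x i).1]/(g i) g_const.
have turn_contact i : exists c, i \in turns ->
    [set g i; g (ordS i)] = [set (fst_end S c).1; (snd_end S c).1] /\
    p (f (ordS i)) = corner S (fst_end S c).1 (fst_end S c).2.
  have [|_] := boolP (i \in turns); last first.
    (* A default contact for positions that are not turns; any turn supplies one. *)
    have /card_gt0P[c _] : (0 < #|K|)%N.
      have /set0Pn[j] := turns_n0; rewrite inE => gj.
      have [v fv] := f_tgt j; have [v' fv'] := f_src (ordS j).
      have := congr1 p fv'; rewrite fv !p_rank.
      case/(places_meet gj (in_gadget_gpos _ _) (in_gadget_gpos _ _)) => c _.
      by apply/card_gt0P; exists c.
    by exists c.
  rewrite inE => gi; have [v fv] := f_tgt i; have [v' fv'] := f_src (ordS i).
  have := congr1 p fv'; rewrite fv !p_rank.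
  case/(places_meet gi (in_gadget_gpos _ _) (in_gadget_gpos _ _)) => c [gc pc].
  by exists c => _; split.
have [c cP] := fin_all_exists turn_contact.
(* The contact determines the vertex at which the cycle turns, and a cycle visits each vertex
   once. *)
have c_inj : {in turns &, injective c}.
  move=> i j /cP[_ pi] /cP[_ pj] cij; apply: (@ordS_inj l); apply: f_inj.
  by apply: p_inj; rewrite pi pj cij.
have : (l < #|c @: turns|)%N.
  apply: (@girth_gt _ _ _ _ S).
    have /set0Pn[i iT] := turns_n0; apply/set0Pn; exists (c i).
    exact: imset_f.
  move=> phi.
  (* The contacts of the cycle that cross the cut [phi] correspond to the changes of [phi] along the
     cycle, so [even_changes] applies. *)
  have -> : [set k in c @: turns |
      phi (fst_end S k).1 != phi (snd_end S k).1] =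
      c @: [set i | phi (g i) != phi (g (ordS i))].
    have phi_c i : i \in turns -> (phi (g i) != phi (g (ordS i))) =
        (phi (fst_end S (c i)).1 != phi (snd_end S (c i)).1).
      move=> /cP[/setP gc _].
      have := gc (g i); have := gc (g (ordS i)); rewrite !inE !eqxx orbT /=.
      have := gc (fst_end S (c i)).1; have := gc (snd_end S (c i)).1.
      rewrite !inE !eqxx orbT /=.
      move=> /orP[]/eqP -> /orP[]/eqP -> /esym/orP[]/eqP E /esym/orP[]/eqP E';
        by rewrite ?E ?E' ?eqxx // eq_sym.
    apply/setP => k; apply/setIdP/imsetP => [[/imsetP[i iT ->] phi_k]|].
      by exists i; rewrite // inE phi_c.
    move=> [i]; rewrite inE => phi_i ->.
    have iT : i \in turns by rewrite inE; apply: contraNneq phi_i => ->.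
    by rewrite imset_f // -phi_c.
  rewrite card_in_imset ?even_changes //.
  have sub i : i \in [set i | phi (g i) != phi (g (ordS i))] -> i \in turns.
    by rewrite !inE; apply: contraNneq => ->.
  by move=> i j /sub iT /sub jT; exact: c_inj.
rewrite ltnNge card_in_imset //; apply/negP/negPn.
by rewrite -[X in (_ <= X)%N](card_ord l) max_card.
Qed.

(** * The base multigraph *)

(* Two parallel spines are joined by m upper and q + 1 lower strands. A strand
   has [slack] + 1 inner pieces, and it is attached to the spine pieces number
   [foot1] and [foot2]. Two strands i, j and the spines between them form a
   closed curve with slack i + slack j + 4 + |foot1 i - foot1 j| +
   |foot2 i - foot2 j| joints; this is l + 1 if the curve bounds a face and at
   least l + 1 in general. *)
Definition strand (m q : nat) : finType := ('I_m + 'I_q.+1)%type.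

Definition foot1 m q (i : strand m q) : nat :=
  match i with inl a => 2 * a + 5 | inr b => 2 * b end%N.

Definition foot2 m q (i : strand m q) : nat :=
  match i with inl a => 2 * a | inr b => (2 * b).+1 end%N.

Definition slack m q l (i : strand m q) : nat :=
  (match i with
   | inl a => if odd a then l - 3 - (l - 5)./2 else (l - 5)./2
   | inr b => if odd b then l - 3 - uphalf (l - 5) else uphalf (l - 5)
   end - 2)%N.

Definition piece (m q l : nat) : finType :=
  ('I_(2 * m).+4 + 'I_(2 * q).+2 + {i : strand m q & 'I_(slack l i).+1})%type.

Definition joint (m q l : nat) : finType :=
  ('I_(2 * m).+3 + 'I_(2 * q).+1 + {i : strand m q & 'I_(slack l i).+2})%type.

Definition spine1 m q l (j : nat) : piece m q l := inl (inl (inord j)).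
Definition spine2 m q l (j : nat) : piece m q l := inl (inr (inord j)).
Definition link m q l (i : strand m q) (k : nat) : piece m q l :=
  inr (existT (fun i => 'I_(slack l i).+1) i (inord k)).
Definition strand_joint m q l (i : strand m q) (k : nat) : joint m q l :=
  inr (existT (fun i => 'I_(slack l i).+2) i (inord k)).

Definition joint_fst m q l (c : joint m q l) : piece m q l * option bool :=
  match c with
  | inl (inl k) => (spine1 _ _ _ k, Some true)
  | inl (inr k) => (spine2 _ _ _ k, Some true)
  | inr (existT i k) =>
      if k == 0 :> nat then (spine1 _ _ _ (foot1 i), None)
      else (link l i k.-1, Some true)
  end.

Definition joint_snd m q l (c : joint m q l) : piece m q l * option bool :=
  match c with
  | inl (inl k) => (spine1 _ _ _ k.+1, Some false)
  | inl (inr k) => (spine2 _ _ _ k.+1, Some false)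
  | inr (existT i k) =>
      if k == (slack l i).+1 :> nat then (spine2 _ _ _ (foot2 i), None)
      else (link l i k, Some false)
  end.

Lemma foot1_lt m q (i : strand m q) : (q <= m.+1)%N -> (foot1 i < (2 * m).+4)%N.
Proof. by case: i => i q_le; have := ltn_ord i; rewrite /foot1; lia. Qed.

Lemma foot2_lt m q (i : strand m q) : (m <= q.+1)%N -> (foot2 i < (2 * q).+2)%N.
Proof. by case: i => i m_le; have := ltn_ord i; rewrite /foot2; lia. Qed.

Lemma foot1_inj m q : injective (@foot1 m q).
Proof.
by move=> [i|i] [j|j] /= ij; try lia; congr (_ _); apply: val_inj => /=; lia.
Qed.

Lemma foot2_inj m q : injective (@foot2 m q).
Proof.
by move=> [i|i] [j|j] /= ij; try lia; congr (_ _); apply: val_inj => /=; lia.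
Qed.

Lemma slack_ge m q l (i : strand m q) : (11 <= l)%N ->
  (l <= 2 * slack l i + 10)%N.
Proof. by case: i => i l_ge; rewrite /slack; case: ifP => _; lia. Qed.

(** The sum of [slack + 2] over both strands is l - 3 for opposite parities on one side, where the
    feet are at least 2 apart at each end, and at least l - 6 for equal parities, where they are at
    least 4 apart. On different sides it is at least l - 5, and |2d + 5| + |2d - 1| >= 6. *)
Lemma strands_far m q l (i j : strand m q) : (11 <= l)%N -> i != j ->
  (l < slack l i + slack l j + 4 +
    ((foot1 i - foot1 j) + (foot1 j - foot1 i)) +
    ((foot2 i - foot2 j) + (foot2 j - foot2 i)))%N.
Proof.
move=> l_ge; case: i j => [i|i] [j|j] ij; rewrite /slack /=.
- have {}ij : i != j :> nat by apply: contra_neq ij => /val_inj ->.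
  have [ij'|ij'] : (i < j)%N \/ (j < i)%N by lia.
    by case: ifP => ?; case: ifP => ?; lia.
  by case: ifP => ?; case: ifP => ?; lia.
- by case: ifP => ?; case: ifP => ?; lia.
- by case: ifP => ?; case: ifP => ?; lia.
- have {}ij : i != j :> nat by apply: contra_neq ij => /val_inj ->.
  have [ij'|ij'] : (i < j)%N \/ (j < i)%N by lia.
    by case: ifP => ?; case: ifP => ?; lia.
  by case: ifP => ?; case: ifP => ?; lia.
Qed.

Lemma joint_snd_inj m q l : (m <= q.+1)%N -> injective (@joint_snd m q l).
Proof.
move=> m_le [[k|k]|[i k]] [[k'|k']|[i' k']] //=; try by case: ifP.
- move=> [] /(congr1 val) /=; have := ltn_ord k; have := ltn_ord k'.
  move=> k'_lt k_lt; rewrite !inordK // => -[kk'].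
  by congr (inl (inl _)); apply: val_inj.
- move=> [] /(congr1 val) /=; have := ltn_ord k; have := ltn_ord k'.
  move=> k'_lt k_lt; rewrite !inordK // => -[kk'].
  by congr (inl (inr _)); apply: val_inj.
- case: eqP => [kl|kl]; case: eqP => [kl'|kl'] // [].
  + move=> /(congr1 val) /=; rewrite !inordK ?foot2_lt // => /foot2_inj ii'.
    by case: _ / ii' k' kl' => k' kl'; congr inr; congr existT;
      apply: val_inj; rewrite /= kl kl'.
  + move=> ii'; case: _ / ii' k' kl' => k' kl' /eqP; rewrite -tag_eqE /tag_eq.
    rewrite /= eqxx tagged_asE => /eqP /(congr1 val) /=; rewrite !inordK.
    * by move/val_inj ->.
    * by have := ltn_ord k'; lia.
    * by have := ltn_ord k; lia.
Qed.

Lemma joint_fst_neq m q l (c c' : joint m q l) : joint_fst c != joint_snd c'.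
Proof.
apply/eqP; case: c c' => [[k|k]|[i k]] [[k'|k']|[i' k']] //=; by do ?case: ifP.
Qed.

(** * Sets of joints that meet every cut evenly *)

Lemma card_sum_sigma (T1 T2 I : finType) (J : I -> finType)
    (A : {set T1 + T2 + {i : I & J i}}) :
  #|A| = (\sum_k (inl (inl k) \in A) + \sum_k (inl (inr k) \in A) +
          \sum_i \sum_k (inr (existT J i k) \in A))%N.
Proof.
rewrite -sum1_card big_mkcond !big_sumType; congr (_ + _)%N.
rewrite (sig_big_dep xpredT (fun=> xpredT)
  (fun i k => (inr (existT J i k) \in A) : nat)).
by apply: eq_bigr => -[i k].
Qed.

Lemma even_pair (T : finType) (D : {set T}) (c c' : T) : c != c' ->
  ~~ odd #|[set d in D | (d == c) || (d == c')]| -> (c \in D) = (c' \in D).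
Proof.
move=> cc'; rewrite -sum1dep_card big_mkcondl /= (bigD1 c) ?eqxx //=.
rewrite (big_pred1 c') => [|d]; last first.
  by case: (eqVneq d c) => [->|]; rewrite /= ?andbT // (negPf cc').
by case: (c \in D); case: (c' \in D).
Qed.

Lemma sum_interval (n a b : nat) : (b <= n)%N ->
  (b - a <= \sum_(k < n) (a <= k < b))%N.
Proof.
elim: n b => [|n IH] b b_le; first by lia.
rewrite big_ord_recr /=; have [b_lt|b_ge] := leqP b n.
  by apply: leq_trans (IH _ b_lt) _; rewrite leq_addr.
have -> : b = n.+1 by lia.
have -> : (\sum_(i < n) (a <= i < n.+1) = \sum_(i < n) (a <= i < n))%N.
  by apply: eq_bigr => i _; have := ltn_ord i; lia.
by have := IH n (leqnn n); lia.
Qed.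

Section EvenJointSet.
Variables (m q l : nat) (D : {set joint m q l}).
Hypotheses (l_ge : (11 <= l)%N) (q_le : (q <= m.+1)%N) (m_le : (m <= q.+1)%N).
Hypothesis D_even : forall phi : piece m q l -> bool,
  ~~ odd #|[set c in D | phi (joint_fst c).1 != phi (joint_snd c).1]|.

Let S := [set i : strand m q | strand_joint l i 0 \in D].

(** The cut around the first k links of the strand meets only its joints 0 and k. *)
Lemma strand_joint_const i (k : 'I_(slack l i).+2) :
  (inr (existT _ i k) \in D) = (i \in S).
Proof.
have [k0|k_gt0] := posnP k.
  by rewrite inE /strand_joint; congr (inr (existT _ i _) \in D);
    apply: val_inj; rewrite /= inordK.
rewrite inE; apply/esym/even_pair.
  apply/eqP => -[/eqP]; rewrite -tag_eqE /tag_eq /= eqxx tagged_asE.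
  by move=> /eqP /(congr1 val) /=; rewrite inordK //; lia.
have := D_even (fun g => match g with
  | inr (existT i' k') => (i' == i) && (k' < k)%N | _ => false end).
congr (~~ odd _); apply: eq_card => c; rewrite !inE; congr (_ && _).
case: c => [[c|c]|[i' k']] //=; rewrite ?eqxx //.
have [ii'|ii'] := eqVneq i' i; last first.
  transitivity false; first by case: ifP; case: ifP; rewrite /= ?(negPf ii').
  pose strand_of (c : joint m q l) := if c is inr p then tag p else i.
  by apply/esym/norP; split; apply: contra_neq ii' => /(congr1 strand_of).
case: _ / ii' k k_gt0 => k k_gt0.
have eq_joint (k1 k2 : 'I_(slack l i').+2) :
    (inr (existT _ i' k1) == inr (existT _ i' k2) :> joint m q l) = (k1 == k2).
  by rewrite (inj_eq (@inr_inj _ _)) -tag_eqE /tag_eq /= eqxx tagged_asE.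
rewrite /strand_joint !eq_joint -!val_eqE /= inordK //.
have k'_lt := ltn_ord k'; have k_lt := ltn_ord k.
case: (k' =P 0 :> nat) => [k'0|k'0]; case: (k' =P (slack l i').+1 :> nat) => k'l;
  rewrite /= ?eqxx ?inordK; try lia.
Qed.

(** The cut around the pieces 0, ..., k of the first spine meets joint 0 of each strand attached
    there and the spine joint behind piece k. Behind the last piece there is none, and [insub]
    fails. *)
Lemma spine1_joint (k : 'I_(2 * m).+4) :
  odd (\sum_(i in S) (foot1 i <= k)) =
  (if insub (k : nat) is Some k' then inl (inl k') \in D else false).
Proof.
have := D_even (fun g => match g with inl (inl j) => (j <= k)%N | _ => false end).
rewrite card_sum_sigma [X in (_ + X + _)%N]big1 => [|k' _]; last first.
  by rewrite inE /= andbF.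
rewrite addn0 oddD negb_add => /eqP/esym.
have -> : (\sum_i \sum_(k' < (slack l i).+2)
      (inr (existT _ i k') \in [set c in D |
        (match (joint_fst c).1 with inl (inl j) => j <= k | _ => false end)
          != (match (joint_snd c).1 with inl (inl j) => j <= k | _ => false end)])
    = \sum_(i in S) (foot1 i <= k))%N.
  rewrite [RHS]big_mkcond; apply: eq_bigr => i _.
  rewrite big_ord_recl big1 => [|k' _]; last first.
    by rewrite inE /=; case: ifP => _ /=; rewrite andbF.
  rewrite inE strand_joint_const /= inordK ?foot1_lt // addn0.
  by case: (i \in S); case: (_ <= _)%N.
move=> ->; case: insubP => [k' _ k'k|k_ge].
  rewrite (bigD1 k') //= big1 => [|k'' k''k].
    rewrite inE /= !inordK ?ltnS -?k'k ?leqnn ?ltnn ?andbT ?addn0 ?oddb //;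
      by have := ltn_ord k'; lia.
  rewrite inE /= !inordK ?ltnS; try by have := ltn_ord k''; lia.
  have : k'' != k' :> nat by apply: contra_neq k''k => /val_inj.
  by rewrite -k'k; case: (ltngtP k'' k'); rewrite ?andbF.
rewrite big1 // => k' _; have k'_lt := ltn_ord k'.
by rewrite inE /= !inordK ?ltnS; lia.
Qed.

(** The same cut on the second spine, which meets the last joint of a strand. *)
Lemma spine2_joint (k : 'I_(2 * q).+2) :
  odd (\sum_(i in S) (foot2 i <= k)) =
  (if insub (k : nat) is Some k' then inl (inr k') \in D else false).
Proof.
have := D_even (fun g => match g with inl (inr j) => (j <= k)%N | _ => false end).
rewrite card_sum_sigma [X in (X + _ + _)%N]big1 => [|k' _]; last first.
  by rewrite inE /= andbF.
rewrite add0n oddD negb_add => /eqP/esym.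
have -> : (\sum_i \sum_(k' < (slack l i).+2)
      (inr (existT _ i k') \in [set c in D |
        (match (joint_fst c).1 with inl (inr j) => j <= k | _ => false end)
          != (match (joint_snd c).1 with inl (inr j) => j <= k | _ => false end)])
    = \sum_(i in S) (foot2 i <= k))%N.
  rewrite [RHS]big_mkcond; apply: eq_bigr => i _.
  rewrite big_ord_recr /= big1 => [|k' _]; last first.
    have k'_neq : (k' == (slack l i).+1 :> nat) = false by rewrite ltn_eqF.
    by rewrite inE /= k'_neq; case: ifP => _; rewrite /= andbF.
  rewrite inE strand_joint_const /= eqxx /= inordK ?foot2_lt // add0n.
  by case: (i \in S); case: (_ <= _)%N.
move=> ->; case: insubP => [k' _ k'k|k_ge].
  rewrite (bigD1 k') //= big1 => [|k'' k''k].
    rewrite inE /= !inordK ?ltnS -?k'k ?leqnn ?ltnn ?andbT ?addn0 ?oddb //;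
      by have := ltn_ord k'; lia.
  rewrite inE /= !inordK ?ltnS; try by have := ltn_ord k''; lia.
  have : k'' != k' :> nat by apply: contra_neq k''k => /val_inj.
  by rewrite -k'k; case: (ltngtP k'' k'); rewrite ?andbF.
rewrite big1 // => k' _; have k'_lt := ltn_ord k'.
by rewrite inE /= !inordK ?ltnS; lia.
Qed.

Lemma spine1_jointE (k : 'I_(2 * m).+3) :
  (inl (inl k) \in D) = odd (\sum_(i in S) (foot1 i <= k)).
Proof.
by rewrite (spine1_joint (widen_ord (leqnSn _) k)) /= valK.
Qed.

Lemma spine2_jointE (k : 'I_(2 * q).+1) :
  (inl (inr k) \in D) = odd (\sum_(i in S) (foot2 i <= k)).
Proof.
by rewrite (spine2_joint (widen_ord (leqnSn _) k)) /= valK.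
Qed.

(** The cut around the whole first spine meets each strand once and no spine joint. *)
Lemma even_strands : odd #|S| = false.
Proof.
have := spine1_joint ord_max; rewrite insubF ?ltnn // => <-.
rewrite -sum1_card; congr odd; apply: eq_bigr => i _.
by have := foot1_lt i q_le; rewrite ltnS /= => ->.
Qed.

Lemma card_even_joint_set :
  #|D| = (\sum_(k < (2 * m).+3) odd (\sum_(i in S) (foot1 i <= k)) +
          \sum_(k < (2 * q).+1) odd (\sum_(i in S) (foot2 i <= k)) +
          \sum_(i in S) (slack l i).+2)%N.
Proof.
rewrite card_sum_sigma; congr (_ + _ + _)%N.
- by apply: eq_bigr => k _; rewrite spine1_jointE.
- by apply: eq_bigr => k _; rewrite spine2_jointE.
- rewrite [RHS]big_mkcond; apply: eq_bigr => i _.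
  under eq_bigr => k _ do rewrite strand_joint_const.
  by rewrite sum_nat_const card_ord; case: (i \in S); rewrite ?muln1 ?muln0.
Qed.

Lemma two_strands_girth (i j : strand m q) : i != j -> S = [set i; j] ->
  (l < #|D|)%N.
Proof.
move=> ij S_ij; rewrite card_even_joint_set S_ij.
have split_sum (F : strand m q -> nat) :
    (\sum_(h in [set i; j]) F h = F i + F j)%N.
  by rewrite big_setU1 ?inE //= big_set1.
(* The parity is odd exactly between the two feet. *)
have spine_len n (a b : nat) : (a <= n)%N -> (b <= n)%N ->
    ((a - b) + (b - a) <= \sum_(k < n) odd ((a <= k) + (b <= k)))%N.
  move=> a_le b_le; have := sum_interval b a_le; have := sum_interval a b_le.
  move=> ba ab; apply: leq_trans (leq_add ab ba) _; rewrite -big_split leq_sum //.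
  by move=> k _; case: (leqP a k); case: (leqP b k).
rewrite split_sum; under eq_bigr => k _ do rewrite split_sum.
under [X in (_ + X + _)%N]eq_bigr => k _ do rewrite split_sum.
have f1 (h : strand m q) : (foot1 h <= (2 * m).+3)%N by exact: foot1_lt.
have f2 (h : strand m q) : (foot2 h <= (2 * q).+1)%N by exact: foot2_lt.
have := strands_far l_ge ij.
have := spine_len _ _ _ (f1 i) (f1 j); have := spine_len _ _ _ (f2 i) (f2 j).
move: (\sum_(k < (2 * m).+3) _)%N (\sum_(k < (2 * q).+1) _)%N => s1 s2.
lia.
Qed.

Lemma four_strands_girth : (3 < #|S|)%N -> (l < #|D|)%N.
Proof.
move=> S_gt3; rewrite card_even_joint_set.
have : (\sum_(i in S) uphalf (l - 6) <= \sum_(i in S) (slack l i).+2)%N.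
  by apply: leq_sum => i _; have := slack_ge i l_ge; lia.
rewrite sum_nat_const => slack_sum.
have : (4 * uphalf (l - 6) <= #|S| * uphalf (l - 6))%N by rewrite leq_mul2r S_gt3 orbT.
(* For l = 12 the bound from four strands is only l, so one spine joint is added. *)
suff : (0 < \sum_(k < (2 * m).+3) odd (\sum_(i in S) (foot1 i <= k)))%N by lia.
have [i0 i0S] : exists i, i \in S by apply/card_gt0P; lia.
(* Behind the smallest foot exactly one strand of [S] is attached. A second strand, with a larger
   foot, shows that a joint exists there. *)
have [i iS i_min] : exists2 i, i \in S &
    forall j, j \in S -> (foot1 i <= foot1 j)%N.
  by case: (arg_minnP (@foot1 m q) i0S) => i iS i_min; exists i.
have /card_gt0P[j] : (0 < #|S :\ i|)%N by have := cardsD1 i S; rewrite iS; lia.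
rewrite in_setD1 => /andP[ji jS].
have i_lt : (foot1 i < (2 * m).+3)%N.
  have := i_min j jS; have := foot1_lt j q_le.
  by have : foot1 i != foot1 j by [rewrite eq_sym (inj_eq (@foot1_inj m q))]; lia.
rewrite (bigD1 (Ordinal i_lt)) //= (bigD1 i) //= leqnn big1 ?addn0 // => h.
move=> /andP[hS hi]; apply/eqP; rewrite eqb0 -ltnNge ltn_neqAle.
by rewrite (inj_eq (@foot1_inj m q)) eq_sym hi i_min.
Qed.

Lemma even_joint_set_girth : D != set0 -> (l < #|D|)%N.
Proof.
move=> D_neq0; have [S0|S_neq0] := eqVneq S set0.
  case/negP: D_neq0; rewrite -cards_eq0 card_even_joint_set S0.
  rewrite big_set0 addn0; apply/eqP.
  by under eq_bigr do rewrite big_set0; rewrite big1 //;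
    under eq_bigr do rewrite big_set0; rewrite big1.
have [/eqP/cards2P[i [j [ij S_ij]]]|S_neq2] := eqVneq #|S| 2.
  exact: two_strands_girth S_ij.
move: S_neq0; rewrite -card_gt0 => S_gt0.
by apply: four_strands_girth; have := even_strands; lia.
Qed.

End EvenJointSet.

(** * Numbers of pieces and joints *)

Lemma sum_odd_ord (u a b : nat) :
  (\sum_(k < (2 * u).+1) (if odd k then a else b) = b + u * (a + b))%N.
Proof.
elim: u => [|u IH]; first by rewrite muln0 big_ord1 mul0n addn0.
have -> : ((2 * u.+1).+1 = (2 * u).+3)%N by lia.
do 2 rewrite big_ord_recr /=.
by rewrite IH oddM /= mulSn; lia.
Qed.

(** Both families have an odd number of strands: neighbours pair up to l - 3, and the two unpaired
    strands contribute the two halves of l - 5. *)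
Lemma sum_slack (u v l : nat) : (11 <= l)%N ->
  (\sum_(i : strand (2 * u).+1 (2 * v)) (slack l i).+2 =
   l - 5 + (u + v) * (l - 3))%N.
Proof.
move=> l_ge; rewrite big_sumType /=.
under eq_bigr => k _.
  rewrite (_ : (_).+2 = if odd k then l - 3 - (l - 5)./2 else (l - 5)./2)%N.
    over.
  by rewrite /slack; case: ifP => _; lia.
under [X in (_ + X)%N]eq_bigr => k _.
  rewrite (_ : (_).+2 = if odd k then l - 3 - uphalf (l - 5)
    else uphalf (l - 5))%N; first over.
  by rewrite /slack; case: ifP => _; lia.
rewrite !sum_odd_ord.
have -> : (l - 3 - (l - 5)./2 + (l - 5)./2 = l - 3)%N by lia.
have -> : (l - 3 - uphalf (l - 5) + uphalf (l - 5) = l - 3)%N by lia.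
by rewrite mulnDl; lia.
Qed.

Lemma card_joint (u v l : nat) : (11 <= l)%N ->
  #|joint (2 * u).+1 (2 * v) l| = ((u + v).+1 * l.+1)%N.
Proof.
move=> l_ge; rewrite -cardsT card_sum_sigma.
under [X in (X + _ + _)%N]eq_bigr do rewrite in_setT.
under [X in (_ + X + _)%N]eq_bigr do rewrite in_setT.
rewrite !sum_nat_const !card_ord !muln1.
under eq_bigr => i _.
  under eq_bigr do rewrite in_setT.
  rewrite sum_nat_const card_ord muln1.
  over.
rewrite sum_slack //.
have [d ->] : exists d, l = (d + 5)%N by exists (l - 5)%N; lia.
by rewrite addnK (_ : d + 5 - 3 = d + 2)%N; nia.
Qed.

Lemma card_piece (u v l : nat) : (11 <= l)%N ->
  (#|piece (2 * u).+1 (2 * v) l| + (2 * (u + v)) = (u + v).+1 * l.+1)%N.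
Proof.
move=> l_ge; rewrite -cardsT card_sum_sigma.
under [X in (X + _ + _ + _)%N]eq_bigr do rewrite in_setT.
under [X in (_ + X + _ + _)%N]eq_bigr do rewrite in_setT.
rewrite !sum_nat_const !card_ord !muln1.
under eq_bigr => i _.
  under eq_bigr do rewrite in_setT.
  rewrite sum_nat_const card_ord muln1.
  over.
have := sum_slack u v l_ge.
under eq_bigr do rewrite -addn1.
rewrite big_split sum_nat_const muln1 card_sum !card_ord /= => sum_eq.
move: sum_eq; set s := (\sum_i _)%N.
have [d ->] : exists d, l = (d + 5)%N by exists (l - 5)%N; lia.
by rewrite addnK (_ : d + 5 - 3 = d + 2)%N; nia.
Qed.

(** * Its drawing *)

Definition sgn (R : realType) (b : bool) : R := if b then 1 else -1.

Definition is_upper m q (i : strand m q) : bool := if i is inl _ then true else false.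

(** The feet of a strand have their apexes at x = [foot1] + 1 and x = - ([foot2] + 1); this is half
    their distance, and [centre] is the midpoint. *)
Definition radius (R : realType) m q (i : strand m q) : R :=
  (foot1 i + foot2 i).+2%:R / 2.

Definition centre (R : realType) m q (i : strand m q) : R :=
  ((foot1 i)%:R - (foot2 i)%:R) / 2.

(* The chain of a strand follows the half circle of radius r about (c, e) in
   the norm |x| + |y|, from (c + r, e) to (c - r, e), where e = 1 for an upper
   and e = - 1 for a lower strand. All links but the last share the quarter
   circle to the right. Third corners lie at distance r + 1. *)
Definition link_corner (R : realType) (c r e : R) (n k : nat) (o : option bool) :
    R * R :=
  if k == n then
    match o with
    | Some false => (c, e * (1 + r))
    | Some true => (c - r, e)
    | None => (c - 1, e * (1 + r))
    end
  else
    match o with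
    | Some false => (c + r - k%:R * (r / n%:R), e * (1 + k%:R * (r / n%:R)))
    | Some true => (c + r - k.+1%:R * (r / n%:R), e * (1 + k.+1%:R * (r / n%:R)))
    | None => (c + r - k.+1%:R * (r / n%:R) + 1, e * (1 + k.+1%:R * (r / n%:R)))
    end.

Definition spine_corner (R : realType) (x d : R) (o : option bool) (e : R) :
    R * R :=
  match o with
  | Some false => (x - d / 2, 0)
  | Some true => (x + d / 2, 0)
  | None => (x, e)
  end.

(* The first spine runs to the right along the x-axis, with piece j above or
   below [j + 1/2, j + 3/2], and the second spine to the left. The apexes
   alternate, so that upper strands leave from upper apexes. *)
Definition piece_corner (R : realType) m q l (g : piece m q l) (o : option bool) :
    R * R :=
  match g with
  | inl (inl j) => spine_corner j.+1%:R 1 o (sgn R (odd j))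
  | inl (inr j) => spine_corner (- j.+1%:R) (- 1) o (sgn R (~~ odd j))
  | inr (existT i k) =>
      link_corner (centre R i) (radius R i) (sgn R (is_upper i)) (slack l i) k o
  end.

Lemma sgn_neq0 (R : realType) b : sgn R b != 0.
Proof. by rewrite /sgn; case: b; rewrite ?oppr_eq0 oner_eq0. Qed.

Lemma radius_gt0 (R : realType) m q (i : strand m q) : 0 < radius R i.
Proof. by rewrite divr_gt0 ?ltr0n. Qed.

Lemma centreD (R : realType) m q (i : strand m q) :
  centre R i + radius R i = (foot1 i).+1%:R.
Proof.
rewrite /centre /radius -[(_ + _).+2]addn2 !natrD.
by rewrite -[(foot1 i).+1]addn1 natrD; lra.
Qed.

Lemma centreB (R : realType) m q (i : strand m q) :
  centre R i - radius R i = - (foot2 i).+1%:R.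
Proof.
rewrite /centre /radius -[(_ + _).+2]addn2 !natrD.
by rewrite -[(foot2 i).+1]addn1 natrD; lra.
Qed.

Lemma slack_gt0 m q l (i : strand m q) : (11 <= l)%N -> (0 < slack l i)%N.
Proof. by move=> l_ge; have := slack_ge i l_ge; lia. Qed.

Lemma piece_corner_free (R : realType) m q l (g : piece m q l) :
  (11 <= l)%N ->
  let a := piece_corner R g (Some false) in let b := piece_corner R g (Some true) in
  let z := piece_corner R g None in
  (b.1 - a.1) * (z.2 - a.2) - (b.2 - a.2) * (z.1 - a.1) != 0.
Proof.
move=> l_ge /=; case: g => [[j|j]|[i k]] /=.
- by apply/eqP; case: odd; rewrite /sgn; lra.
- by apply/eqP; case: odd; rewrite /sgn /=; lra.
have r_gt0 := radius_gt0 R i.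
have n_gt0 : 0 < (slack l i)%:R :> R by rewrite ltr0n slack_gt0.
have d_gt0 := divr_gt0 r_gt0 n_gt0.
have e_neq0 := sgn_neq0 R (is_upper i).
rewrite /link_corner; case: (k =P slack l i :> nat) => _ /=.
  set det := (X in X != 0).
  have -> : det = - (sgn R (is_upper i) * radius R i) by rewrite /det; ring.
  by rewrite oppr_eq0 mulf_neq0 // lt0r_neq0.
rewrite -natr1; move: (radius R i / _) d_gt0 => d d_gt0.
set det := (X in X != 0).
have -> : det = - (sgn R (is_upper i) * d) by rewrite /det; ring.
by rewrite oppr_eq0 mulf_neq0 // lt0r_neq0.
Qed.

Lemma piece_corner_meet (R : realType) m q l (c : joint m q l) :
  (11 <= l)%N -> (q <= m.+1)%N -> (m <= q.+1)%N ->
  piece_corner R (joint_fst c).1 (joint_fst c).2 =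
  piece_corner R (joint_snd c).1 (joint_snd c).2.
Proof.
move=> l_ge q_le m_le; case: c => [[k|k]|[i k]] /=.
- have k_lt := ltn_ord k; rewrite !inordK //; last by lia.
  by rewrite -[k.+2%:R]natr1; congr pair; lra.
- have k_lt := ltn_ord k; rewrite !inordK //; last by lia.
  by rewrite -[k.+2%:R]natr1; congr pair; lra.
have n_gt0 := slack_gt0 i l_ge; have k_lt := ltn_ord k.
have nd : (slack l i)%:R * (radius R i / (slack l i)%:R) = radius R i.
  by rewrite mulrC divfK // pnatr_eq0 -lt0n.
case: eqP => [k0|k_neq0].
  rewrite ifF /=; last by rewrite k0 ltn_eqF.
  rewrite !inordK ?foot1_lt //; last by rewrite k0.
  rewrite /link_corner k0 ltn_eqF // mul0r subr0 addr0 mulr1 centreD.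
  by congr (_, sgn _ _); case: i {k k_lt k0 n_gt0 nd} => i; rewrite /foot1 /=; lia.
case: eqP => [kn|k_neqn] /=.
  rewrite !inordK ?foot2_lt ?kn //= /link_corner eqxx centreB.
  by congr (_, sgn _ _); case: i {k k_lt kn k_neq0 n_gt0 nd} => i; rewrite /foot2 /=; lia.
rewrite !inordK; [|lia..].
rewrite /link_corner ifF; last by lia.
rewrite prednK; last by lia.
by case: eqP => [->|//]; rewrite nd addrK.
Qed.

(** * Distinct triangles share only the prescribed corners *)

Lemma bary_spine (R : realType) (x d e u v : R) :
  bary (spine_corner x d ^~ e) u v = (x + d * (u + v / 2 - 1 / 2), e * v).
Proof. by rewrite /bary /=; congr pair; lra. Qed.

Lemma bary_last (R : realType) (c r e u v : R) n :
  bary (link_corner c r e n n) u v = (c - (u * r + v), e * (1 + (r - u * r))).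
Proof. by rewrite /bary /link_corner eqxx /=; congr pair; lra. Qed.

Lemma bary_link (R : realType) (c r e u v : R) n k : k != n ->
  bary (link_corner c r e n k) u v =
    (c + (r - (k%:R + u + v) * (r / n%:R) + v),
     e * (1 + (k%:R + u + v) * (r / n%:R))).
Proof.
move=> kn; rewrite /bary /link_corner (negPf kn) /= -natr1.
by congr pair; ring.
Qed.

Section TrianglesMeet.
Variables (R : realType) (m q l : nat).
Hypotheses (l_ge : (11 <= l)%N) (q_le : (q <= m.+1)%N) (m_le : (m <= q.+1)%N).
Local Notation pc := (@piece_corner R m q l).
Local Notation r := (radius R).
Local Notation c := (centre R).
Local Notation sgn_of i := (sgn R (is_upper i)).

Definition meet_at (g g' : piece m q l) (P : R * R) : Prop :=
  exists d : joint m q l, [set g; g'] = [set (joint_fst d).1; (joint_snd d).1] /\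
    P = pc (joint_fst d).1 (joint_fst d).2.

Definition meet_well (g g' : piece m q l) : Prop :=
  forall u v u' v' : R, 0 <= u -> 0 <= v -> u + v <= 1 ->
    0 <= u' -> 0 <= v' -> u' + v' <= 1 ->
    bary (pc g) u v = bary (pc g') u' v' -> meet_at g g' (bary (pc g) u v).

Lemma meet_well_sym g g' : meet_well g g' -> meet_well g' g.
Proof.
move=> gg' u v u' v' u0 v0 uv u'0 v'0 uv' E; have [d [gd Pd]] :=
  gg' _ _ _ _ u'0 v'0 uv' u0 v0 uv (esym E).
by exists d; rewrite E setUC.
Qed.

Lemma spine1E (j : 'I_(2 * m).+4) : inl (inl j) = spine1 m q l j.
Proof. by rewrite /spine1 inord_val. Qed.

Lemma spine2E (j : 'I_(2 * q).+2) : inl (inr j) = spine2 m q l j.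
Proof. by rewrite /spine2 inord_val. Qed.

Lemma linkE (i : strand m q) (k : 'I_(slack l i).+1) :
  inr (existT _ i k) = link l i k.
Proof. by rewrite /link inord_val. Qed.

Lemma bary_spine1 (j : 'I_(2 * m).+4) (u v : R) :
  bary (pc (inl (inl j))) u v = (j.+1%:R + (u + v / 2 - 1 / 2), sgn R (odd j) * v).
Proof. by rewrite [LHS](bary_spine j.+1%:R 1) mul1r. Qed.

Lemma bary_spine2 (j : 'I_(2 * q).+2) (u v : R) :
  bary (pc (inl (inr j))) u v =
    (- (j.+1%:R + (u + v / 2 - 1 / 2)), sgn R (~~ odd j) * v).
Proof. by rewrite [LHS](bary_spine (- j.+1%:R) (-1)) mulN1r -opprD. Qed.

(** The offset u + v / 2 - 1 / 2 stays in [-1/2, 1/2] and is 1/2 only at u = 1, v = 0, while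
    positions differ by at least 1. *)
Lemma spine_step (j j' : nat) (u v u' v' : R) : (j < j')%N ->
  0 <= u -> 0 <= v -> u + v <= 1 -> 0 <= u' -> 0 <= v' -> u' + v' <= 1 ->
  j.+1%:R + (u + v / 2 - 1 / 2) = j'.+1%:R + (u' + v' / 2 - 1 / 2) ->
  [/\ j' = j.+1, u = 1 & v = 0].
Proof.
move=> jj' u0 v0 uv u'0 v'0 uv' E.
have j_le : j.+2%:R <= j'.+1%:R :> R by rewrite ler_nat.
have j_step : j.+2%:R = j.+1%:R + 1 :> R by rewrite natr1.
suff : [/\ j'.+1%:R = j.+2%:R :> R, u = 1 & v = 0].
  by case=> /eqP; rewrite eqr_nat => /eqP[].
move: (j.+1%:R : R) (j.+2%:R : R) (j'.+1%:R : R) E j_le j_step => a b b' E b_le b_eq.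
by split; lra.
Qed.

Lemma spine1_meet_well (j j' : 'I_(2 * m).+4) : (j < j')%N ->
  meet_well (inl (inl j)) (inl (inl j')).
Proof.
move=> jj' u v u' v' u0 v0 uv u'0 v'0 uv'; rewrite !bary_spine1 => -[X _].
have [j'j u1 v00] := spine_step jj' u0 v0 uv u'0 v'0 uv' X.
have j_lt : (j < (2 * m).+3)%N by have := ltn_ord j'; lia.
exists (inl (inl (Ordinal j_lt))); rewrite /=.
have -> : spine1 m q l j.+1 = inl (inl j') by rewrite spine1E j'j.
rewrite -!spine1E; split=> //=.
by rewrite u1 v00 mulr0 mul0r inordK 1?ltnW //; congr pair; lra.
Qed.

Lemma spine2_meet_well (j j' : 'I_(2 * q).+2) : (j < j')%N ->
  meet_well (inl (inr j)) (inl (inr j')).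
Proof.
move=> jj' u v u' v' u0 v0 uv u'0 v'0 uv'; rewrite !bary_spine2 => -[/oppr_inj X _].
have [j'j u1 v00] := spine_step jj' u0 v0 uv u'0 v'0 uv' X.
have j_lt : (j < (2 * q).+1)%N by have := ltn_ord j'; lia.
exists (inl (inr (Ordinal j_lt))); rewrite /=.
have -> : spine2 m q l j.+1 = inl (inr j') by rewrite spine2E j'j.
rewrite -!spine2E; split=> //=.
by rewrite u1 v00 mulr0 mul0r inordK 1?ltnW //; congr pair; lra.
Qed.

Lemma spines_meet_well (j : 'I_(2 * m).+4) (j' : 'I_(2 * q).+2) :
  meet_well (inl (inl j)) (inl (inr j')).
Proof.
move=> u v u' v' u0 v0 uv u'0 v'0 uv'; rewrite bary_spine1 bary_spine2 => -[X _].
have := ler1n R j.+1; have := ler1n R j'.+1; rewrite !ltn0Sn.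
by move: (j.+1%:R : R) (j'.+1%:R : R) X => a b X b1 a1; exfalso; lra.
Qed.

(** In the coordinates U, V relative to the centre of the half circle, v is the distance by which a
    point lies outside radius r. Only the last link lies on the side U <= 0. *)
Lemma bary_piece_link (i : strand m q) (k : 'I_(slack l i).+1) (u v : R) :
  0 <= u -> 0 <= v -> u + v <= 1 ->
  exists U V, [/\ bary (pc (inr (existT _ i k))) u v = (c i + U, sgn_of i * (1 + V)),
    0 <= V, `|U| + V = r i + v &
    if k == slack l i :> nat then U = - (u * r i + v) /\ V = r i - u * r i
    else [/\ 0 <= U, U = r i - V + v & V = (k%:R + u + v) * (r i / (slack l i)%:R)]].
Proof.
move=> u0 v0 uv; have r0 := radius_gt0 R i.
case: eqP => [kn|kn].
  exists (- (u * r i + v)), (r i - u * r i); split=> //.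
  - by rewrite -[LHS]/(bary (link_corner _ _ _ _ k) u v) kn bary_last.
  - by nra.
  - by rewrite normrN ger0_norm; nra.
have n0 : 0 < (slack l i)%:R :> R by rewrite ltr0n slack_gt0.
have d0 : 0 < r i / (slack l i)%:R by exact: divr_gt0.
have V0 : 0 <= (k%:R + u + v) * (r i / (slack l i)%:R).
  by apply: mulr_ge0; [rewrite !addr_ge0|exact: ltW].
have V1 : (k%:R + u + v) * (r i / (slack l i)%:R) <= r i.
  have : k.+1%:R <= (slack l i)%:R :> R.
    by rewrite ler_nat; have := ltn_ord k; lia.
  rewrite -natr1 => k_le; rewrite mulrA ler_pdivrMr // mulrC ler_pM2l //; lra.
exists (r i - (k%:R + u + v) * (r i / (slack l i)%:R) + v).
exists ((k%:R + u + v) * (r i / (slack l i)%:R)); split=> //.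
- rewrite -[LHS]/(bary (link_corner _ _ _ _ k) u v) bary_link //.
  exact/eqP.
- by rewrite ger0_norm; lra.
- by split=> //; lra.
Qed.

(** Spine triangles stay in |y| <= 1 and links in |y| >= 1, so a common point is the apex of the
    spine triangle. *)
Lemma sgn_mul_eq (b b' : bool) (v V : R) : 0 <= v -> v <= 1 -> 0 <= V ->
  sgn R b * v = sgn R b' * (1 + V) -> v = 1 /\ V = 0.
Proof. by move=> v0 v1 V0; rewrite /sgn; case: b; case: b' => E; split; lra. Qed.

Lemma spine1_link_meet_well (j : 'I_(2 * m).+4) (i : strand m q)
    (k : 'I_(slack l i).+1) :
  meet_well (inl (inl j)) (inr (existT _ i k)).
Proof.
move=> u v u' v' u0 v0 uv u'0 v'0 uv'.
have [U [V [-> V0 _ UV]]] := bary_piece_link k u'0 v'0 uv'.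
rewrite bary_spine1 => -[X Y]; have v_le : v <= 1 by lra.
have [v1 {}V0] := sgn_mul_eq v0 v_le V0 Y.
have r0 := radius_gt0 R i; have u00 : u = 0 by lra.
(* At V = 0 the last link has negative x, whereas the first spine has positive x; the other links
   reach V = 0 only at the start of link 0. *)
have j0 := ler0n R j; case: eqP UV => [kn [UE VE]|kn [U0 UE VE]].
  have u1 : u' = 1 by apply: (mulIf (lt0r_neq0 r0)); lra.
  have := centreB R i; have : 1 <= (foot2 i).+1%:R :> R by rewrite ler1n.
  have : 1 <= j.+1%:R :> R by rewrite ler1n.
  by move=> *; exfalso; lra.
have n0 : 0 < (slack l i)%:R :> R by rewrite ltr0n slack_gt0.
have d0 : r i / (slack l i)%:R != 0 by apply: lt0r_neq0; exact: divr_gt0.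
have : k%:R + u' + v' = 0 by apply: (mulIf d0); rewrite -VE V0 mul0r.
have k_ge := ler0n R k => kuv.
have /eqP : k%:R = 0 :> R by lra.
rewrite pnatr_eq0 => /eqP k0.
have : j.+1%:R = (foot1 i).+1%:R :> R by rewrite -centreD; lra.
move=> /eqP; rewrite eqr_nat => /eqP [] jf.
have link0 : link l i 0 = inr (existT _ i k) by rewrite linkE k0.
exists (strand_joint l i 0); rewrite /= inordK //= link0 -jf -spine1E.
by split=> //=; rewrite inordK // v1 u00 mulr1; congr pair; lra.
Qed.

Lemma spine2_link_meet_well (j : 'I_(2 * q).+2) (i : strand m q)
    (k : 'I_(slack l i).+1) :
  meet_well (inl (inr j)) (inr (existT _ i k)).
Proof.
move=> u v u' v' u0 v0 uv u'0 v'0 uv'.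
have [U [V [-> V0 _ UV]]] := bary_piece_link k u'0 v'0 uv'.
rewrite bary_spine2 => XY; rewrite XY; case: XY => X Y.
have v_le : v <= 1 by lra.
have [v1 {}V0] := sgn_mul_eq v0 v_le V0 Y.
have r0 := radius_gt0 R i; have u00 : u = 0 by lra.
have j0 : 1 <= j.+1%:R :> R by rewrite ler1n.
case: eqP UV => [kn [UE VE]|kn [U0 UE VE]]; last first.
  have := centreD R i; have : 1 <= (foot1 i).+1%:R :> R by rewrite ler1n.
  by move=> *; exfalso; lra.
have u1 : u' = 1 by apply: (mulIf (lt0r_neq0 r0)); lra.
have v'1 : v' = 0 by lra.
have : j.+1%:R = (foot2 i).+1%:R :> R.
  by have := centreB R i; move: X; rewrite UE u1; lra.
move=> /eqP; rewrite eqr_nat => /eqP [] jf.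
exists (strand_joint l i (slack l i).+1); rewrite /= inordK //= eqxx /= -jf -spine2E.
split; first by rewrite -kn -linkE setUC.
rewrite inordK // /link_corner eqxx UE u1 v'1 V0.
by congr pair; lra.
Qed.

Lemma link_link_meet_well (i : strand m q) (k k' : 'I_(slack l i).+1) :
  (k < k')%N -> meet_well (inr (existT _ i k)) (inr (existT _ i k')).
Proof.
move=> kk' u v u' v' u0 v0 uv u'0 v'0 uv'.
have k_neq : (k == slack l i :> nat) = false by have := ltn_ord k'; lia.
have [U [V [-> V0 _]]] := bary_piece_link k u0 v0 uv; rewrite k_neq.
have [U' [V' [-> V'0 _ UV']]] := bary_piece_link k' u'0 v'0 uv'.
case=> U0 UE VE [/addrI UU' /(mulfI (sgn_neq0 _ _)) /addrI VV'].
have r0 := radius_gt0 R i.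
have n0 : 0 < (slack l i)%:R :> R by rewrite ltr0n slack_gt0.
have d0 : 0 < r i / (slack l i)%:R by exact: divr_gt0.
have k_le : k.+1%:R <= k'%:R :> R by rewrite ler_nat.
have nd : (slack l i)%:R * (r i / (slack l i)%:R) = r i.
  by rewrite mulrC divfK ?lt0r_neq0.
have [k'k u1 v1] : [/\ k' = k.+1 :> nat, u = 1 & v = 0].
  (* Each link before the last climbs by r / n, where n is the slack. The last one can be met only
     at U = 0, hence at V = r, the top of link n - 1. *)
  have sum1 : k'%:R <= k%:R + u + v.
    rewrite -(ler_pM2r d0); case: eqP UV' => [k'n [U'E _]|k'n [_ _ V'E]].
      by rewrite k'n nd -VE; nra.
    by rewrite -VE VV' V'E ler_pM2r //; lra.
  have k'k : k' = k.+1 :> nat.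
    apply/eqP; rewrite eqn_leq kk' andbT -(ler_nat R).
    by rewrite -natr1; lra.
  have sum2 : u + v = 1.
    by move: sum1; rewrite k'k -natr1; lra.
  have v1 : v = 0.
    case: eqP UV' => [k'n [U'E V'E]|k'n [_ U'E V'E]].
      have : V = r i by rewrite VE -addrA sum2 natr1 -k'k k'n nd.
      by nra.
    have : V = k'%:R * (r i / (slack l i)%:R).
      by rewrite VE -addrA sum2 natr1 -k'k.
    rewrite VV' V'E => /(mulIf (lt0r_neq0 d0)) kuv.
    by move: UU'; rewrite UE U'E VV'; lra.
  by split=> //; lra.
have k'_lt := ltn_ord k'.
have link_k : link l i k'.-1 = inr (existT _ i k) by rewrite linkE k'k.
exists (strand_joint l i k'); rewrite /= (inordK (ltnW k'_lt)).
have k'0 : (k' == 0 :> nat) = false by rewrite k'k.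
have k'n : (k' == (slack l i).+1 :> nat) = false by rewrite ltn_eqF.
rewrite k'0 k'n; split; first by rewrite /= link_k -linkE.
rewrite [(_, _).1]/= link_k /= /link_corner k_neq UE VE u1 v1.
by rewrite !addr0 natr1; congr pair; lra.
Qed.

(** Strands on one side share their centre, their radii differ by at least 2, and each keeps between
    distances r and r + 1. The x-axis separates the two sides. *)
Lemma links_meet_well (i i' : strand m q) (k : 'I_(slack l i).+1)
    (k' : 'I_(slack l i').+1) :
  i != i' -> meet_well (inr (existT _ i k)) (inr (existT _ i' k')).
Proof.
move=> ii' u v u' v' u0 v0 uv u'0 v'0 uv'.
have [U [V [-> V0 UV _]]] := bary_piece_link k u0 v0 uv.
have [U' [V' [-> V'0 UV' _]]] := bary_piece_link k' u'0 v'0 uv'.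
case; have far : is_upper i = is_upper i' ->
    c i = c i' /\ (r i + 2 <= r i' \/ r i' + 2 <= r i).
  have two_apart (a b : nat) : (a + 4 <= b)%N -> a.+2%:R / 2 + 2 <= b.+2%:R / 2 :> R.
    rewrite -(ler_nat R) natrD -[a.+2]addn2 -[b.+2]addn2 !natrD; lra.
  case: i i' ii' {k k' U V U' V' UV UV' V0 V'0} => [a|a] [b|b] // ab _.
    have {}ab : a != b :> nat by apply: contra_neq ab => /val_inj ->.
    split; first by rewrite /centre /foot1 /foot2 !natrD; lra.
    have [ab'|ab'] : (a < b)%N \/ (b < a)%N by lia.
      by left; apply: two_apart; rewrite /foot1 /foot2; lia.
    by right; apply: two_apart; rewrite /foot1 /foot2; lia.
  have {}ab : a != b :> nat by apply: contra_neq ab => /val_inj ->.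
  split; first by rewrite /centre /foot1 /foot2 -!natr1; lra.
  have [ab'|ab'] : (a < b)%N \/ (b < a)%N by lia.
    by left; apply: two_apart; rewrite /foot1 /foot2; lia.
  by right; apply: two_apart; rewrite /foot1 /foot2; lia.
have [up|up] := eqVneq (is_upper i) (is_upper i'); last first.
  by move=> _; rewrite /sgn; case: (is_upper i) (is_upper i') up => -[] // _; lra.
have [cc rr] := far up; rewrite cc up.
move=> /addrI UU' /(mulfI (sgn_neq0 _ _)) /addrI VV'.
by move: UV; rewrite UU' VV'; lra.
Qed.

Lemma pieces_meet_well g g' : g != g' -> meet_well g g'.
Proof.
case: g g' => [[j|j]|[i k]] [[j'|j']|[i' k']] gg'.
- have [jj'|jj'|/val_inj jj'] := ltngtP j j'.
  + exact: spine1_meet_well.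
  + exact/meet_well_sym/spine1_meet_well.
  + by rewrite jj' eqxx in gg'.
- exact: spines_meet_well.
- exact: spine1_link_meet_well.
- exact/meet_well_sym/spines_meet_well.
- have [jj'|jj'|/val_inj jj'] := ltngtP j j'.
  + exact: spine2_meet_well.
  + exact/meet_well_sym/spine2_meet_well.
  + by rewrite jj' eqxx in gg'.
- exact: spine2_link_meet_well.
- exact/meet_well_sym/spine1_link_meet_well.
- exact/meet_well_sym/spine2_link_meet_well.
- have [ii'|ii'] := eqVneq i i'; last exact: links_meet_well.
  case: _ / ii' k' gg' => k' gg'.
  have [kk'|kk'|/val_inj kk'] := ltngtP k k'.
  + exact: link_link_meet_well.
  + exact/meet_well_sym/link_link_meet_well.
  + by rewrite kk' eqxx in gg'.
Qed.

End TrianglesMeet.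

(** * Assembly and arithmetic *)

Lemma strand_system (R : realType) (m q l : nat) :
  (11 <= l)%N -> (q <= m.+1)%N -> (m <= q.+1)%N ->
  contact_system R l (piece m q l) (joint m q l).
Proof.
move=> l_ge q_le m_le.
exists (@piece_corner R m q l) (@joint_fst m q l) (@joint_snd m q l).
- by move=> g; exact: piece_corner_free.
- by move=> c; exact: piece_corner_meet.
- exact: joint_snd_inj.
- exact: joint_fst_neq.
- by move=> g g' u v u' v' /(pieces_meet_well l_ge q_le m_le); apply.
- by move=> D D_neq0 D_even; exact: (even_joint_set_girth l_ge q_le m_le).
Qed.

(** The (w + 1)(l - 1) + 2 triangles meet in (w + 1)(l + 1) joints, as Euler's formula gives for 2(w
    + 1) faces of length l + 1; n is the number of vertices after merging. *)
Lemma ex_planar_ge (R : realType) (s : nat) (e : bool) (l w n : nat) :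
  (11 <= l)%N -> l = (2 * s + 7 + e)%N ->
  (n + w.+1 * l.+1 = (w.+1 * l.-1 + 2) * (3 * s + 5 + e))%N ->
  ((w.+1 * l.-1 + 2) * (9 * s + 9 + 3 * e) <= ex_planar R n (cycle_graph l))%N.
Proof.
(* Families of nearly equal size keep all feet on the spines. *)
move=> l_ge l_eq n_eq; pose u := w./2; pose v := uphalf w.
have uv : (u + v = w)%N by rewrite /u /v; lia.
have v_le : (2 * v <= (2 * u).+2)%N by rewrite /u /v; lia.
have u_le : ((2 * u).+1 <= (2 * v).+1)%N by rewrite /u /v; lia.
have piece_eq : #|piece (2 * u).+1 (2 * v) l| = (w.+1 * l.-1 + 2)%N.
  have := card_piece u v l_ge; rewrite uv; have -> : l.+1 = (l.-1 + 2)%N by lia.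
  by rewrite mulnDr; lia.
rewrite -piece_eq; apply: contact_bound (strand_system R l_ge v_le u_le) _ l_eq _.
by rewrite card_joint // uv n_eq piece_eq.
Qed.

Theorem theorem7 (R : realType) (l : nat) (hl : (11 <= l)%N) :
  ~ (exists N : nat, forall n : nat, (N <= n)%N ->
       (ex_planar R n (cycle_graph l))%:R <=
         3 * (l%:R - 1) / l%:R * n%:R - 6 * (l%:R + 1) / l%:R :> R)
  /\
  (forall k : nat, (0 < k)%N -> ~~ odd k ->
     (odd l -> forall n : nat,
        n%:R = ((5 * l%:R - 5) * (k%:R / 2) - l%:R + 3)
               * (3 * (l%:R - 1) / 2 - 5) - (5 * k%:R - 4) :> R ->
        9 * (l%:R - 5) * (l%:R - 1) / ((3 * l%:R - 13) * (l%:R - 1) - 4)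
          * (n%:R - 2 * (l%:R + 1) / (l%:R - 1))
        <= (ex_planar R n (cycle_graph l))%:R :> R)
     /\
     (~~ odd l -> forall n : nat,
        n%:R = ((5 * l%:R - 5) * (k%:R / 2) - l%:R + 3)
               * (3 * (l%:R / 2 - 1) - 4) - (5 * k%:R - 4) :> R ->
        3 * (3 * l%:R - 16) * (l%:R - 1) / ((3 * l%:R - 14) * (l%:R - 1) - 4)
          * (n%:R - 2 * (l%:R + 1) / (l%:R - 1))
        <= (ex_planar R n (cycle_graph l))%:R :> R)).
Proof.
have [s [e [l_eq e_eq]]] : exists s (e : bool), l = (2 * s + 7 + e)%N /\ e = ~~ odd l.
  exists ((l - 7)./2), (~~ odd l); split=> //.
  by case: (boolP (odd l)) => l_odd /=; lia.
(* This is where l >= 11 makes the gadget have more than l - 1 vertices. *)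
have s_ge : (2 <= s)%N by move: hl; rewrite l_eq; case: (e) => /=; lia.
have sR : 2 <= s%:R :> R by rewrite ler_nat.
have lR : l%:R = 2 * s%:R + 7 + e%:R :> R by rewrite l_eq 2!natrD natrM.
have l1R : l.-1%:R = 2 * s%:R + 6 + e%:R :> R.
  by rewrite -subn1 natrB ?lR; [lra|lia].
have lSR : l.+1%:R = 2 * s%:R + 8 + e%:R :> R by rewrite -natr1 lR; lra.
have bR : (3 * s + 5 + e)%:R = 3 * s%:R + 5 + e%:R :> R by rewrite 2!natrD natrM.
have dR : (9 * s + 9 + 3 * e)%:R = 9 * s%:R + 9 + 3 * e%:R :> R.
  by rewrite 2!natrD 2!natrM.
have [V VE VR] : exists2 V : nat -> nat, forall w, V w = (w.+1 * l.-1 + 2)%N &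
    forall w, (V w)%:R = w.+1%:R * (2 * s%:R + 6 + e%:R) + 2 :> R.
  exists (fun w => w.+1 * l.-1 + 2)%N => // w.
  by rewrite natrD natrM l1R.
have bound n w : (n%:R + w.+1%:R * (2 * s%:R + 8 + e%:R) =
      (w.+1%:R * (2 * s%:R + 6 + e%:R) + 2) * (3 * s%:R + 5 + e%:R) :> R) ->
    (w.+1%:R * (2 * s%:R + 6 + e%:R) + 2) * (9 * s%:R + 9 + 3 * e%:R) <=
      (ex_planar R n (cycle_graph l))%:R :> R.
  move=> n_eq; rewrite -VR -dR -natrM ler_nat VE; apply: ex_planar_ge => //.
  by apply/eqP; rewrite -VE -(eqr_nat R) natrD 2!natrM lSR VR bR n_eq.
have e01 : e%:R = 0 :> R \/ e%:R = 1 :> R by case: (e); [right|left].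
split=> [[N N_bound]|k k_gt0 k_even].
  (* The member of the family below with j = N, that is, k = 2 (N + 1); it has at least N
     vertices. *)
  pose w := (5 * N + 3)%N.
  have n_le : (N + w.+1 * l.+1 <= V w * (3 * s + 5 + e))%N.
    rewrite VE; have w_ge : (N <= w)%N by rewrite /w; lia.
    have : (l.+1 + 1 <= l.-1 * (3 * s + 5 + e))%N.
      have : (l.-1 * 2 <= l.-1 * (3 * s + 5 + e))%N by rewrite leq_mul2l; lia.
      by lia.
    move=> l_le; have : (w.+1 * (l.+1 + 1) <= w.+1 * (l.-1 * (3 * s + 5 + e)))%N.
      by rewrite leq_mul2l l_le orbT.
    by rewrite mulnDl mulnA mulnDr muln1; lia.
  pose n := (V w * (3 * s + 5 + e) - w.+1 * l.+1)%N.
  have n_eq : n%:R = (V w)%:R * (3 * s%:R + 5 + e%:R) -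
      w.+1%:R * (2 * s%:R + 8 + e%:R) :> R.
    by rewrite natrB; [rewrite 2!natrM lSR bR|lia].
  have /N_bound : (N <= n)%N by rewrite /n; lia.
  have := bound n w; rewrite -VR n_eq subrK => /(_ erefl) ex_ge ex_le.
  have := le_trans ex_ge ex_le.
  have w_gt0 : 0 < w.+1%:R :> R by rewrite ltr0n.
  move: (VR w); move: (V w)%:R (w.+1%:R : R) w_gt0 => y z z_gt0 y_eq {ex_ge ex_le}.
  have l_gt0 : 0 < l%:R :> R by rewrite ltr0n; lia.
  (* Multiplied by l, the excess over the conjectured bound is 3 y (s - 1), which is positive. *)
  rewrite mulrAC -mulrBl ler_pdivlMr // lR.
  by apply/negP; rewrite -ltNge y_eq; case: e01 => ->; nra.
(* With w = 5j + 3 there are (5l - 5) k / 2 - l + 3 triangles and 5k - 4 more joints than triangles,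
   which yields the given n. *)
have [j k_eq] : exists j, k = (2 * j.+1)%N by exists (k./2.-1); lia.
have kR : k%:R = 2 * j%:R + 2 :> R by rewrite k_eq natrM -natr1; lra.
have wR : (5 * j + 3).+1%:R = 5 * j%:R + 4 :> R.
  by rewrite -natr1 natrD natrM; lra.
split=> [l_odd|l_even] n n_eq.
- have eR : e%:R = 0 :> R by rewrite e_eq l_odd.
  apply: le_trans (bound n (5 * j + 3)%N _); rewrite wR ?n_eq kR lR eR; last by lra.
  (* The number of edges equals the stated bound, so a field identity with nonzero denominators
     remains. *)
  rewrite le_eqVlt; apply/orP; left; apply/eqP; field.
  by apply/andP; split; apply: lt0r_neq0; nra.
- have eR : e%:R = 1 :> R by rewrite e_eq l_even.
  apply: le_trans (bound n (5 * j + 3)%N _); rewrite wR ?n_eq kR lR eR; last by lra.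
  rewrite le_eqVlt; apply/orP; left; apply/eqP; field.
  by apply/andP; split; apply: lt0r_neq0; nra.
Qed.
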